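(* Let two segments $[a,b]$ and $[c,d]$ ($a<b$, $c<d$) with $a\le c$ be given, let $\omega$ be a modulus of continuity and $X$ an $L$-space. Set $M=\max\{b-a,d-c\}$, $m=\min\{b-a,d-c\}$ and, for $\alpha,\beta\ge0$, $I(\alpha,\beta)=\int_\alpha^\beta\omega(s)\,ds$. Then for all $f\in H^\omega([a,\max\{b,d\}],X)$ $$h_X\left(\frac1{b-a}\int_a^bf(t)\,dt,\frac1{d-c}\int_c^df(t)\,dt\right)\le\begin{cases}\frac{M-m}{M^2}\left\{I\left(0,\frac{M(c-a)}{M-m}\right)+I\left(0,\frac{M(b-d)}{M-m}\right)\right\},&[c,d]\subset[a,b],\\[4pt] \frac1{M+m}I\left(\frac{M(b-c)}m,d-a\right)+\frac{M-m}{M^2}I\left(0,\frac{M(b-c)}m\right),& b\in[c,d],\\[4pt] \frac1{M+m}I(c-b,d-a),& c\ge b.\end{cases}$$ (If $[c,d]=[a,b]$, so that $M=m$, the first expression is understood as $0$.) If $X$ is isotropic and $\omega$ is concave, then the inequality is sharp, i.e. the supremum of the left-hand side over $f\in H^\omega([a,\max\{b,d\}],X)$ equals the right-hand side.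
   Context: A modulus of continuity is a non-decreasing continuous semi-additive function $\omega\colon[0,\infty)\to[0,\infty)$ (i.e. $\omega(s+t)\le\omega(s)+\omega(t)$) with $\omega(0)=0$. A semilinear space is a set $X$ with addition and multiplication by real numbers such that for all $x,y,z\in X$, $\alpha,\beta\in\mathbb R$: $x+y=y+x$; $x+(y+z)=(x+y)+z$; there is $\theta\in X$ with $x+\theta=x$ for all $x$; $\alpha(x+y)=\alpha x+\alpha y$; $\alpha(\beta x)=(\alpha\beta)x$; $1\cdot x=x$, $0\cdot x=\theta$. An $L$-space is a semilinear space $X$ with a complete separable metric $h_X$ such that $h_X(\alpha x,\alpha y)=|\alpha|h_X(x,y)$ and $h_X(x+z,y+z)\le h_X(x,y)$; it is isotropic if the last inequality is always an equality. An element $x$ is convex if $(\alpha+\beta)x=\alpha x+\beta x$ for all $\alpha,\beta\ge0$; $X^{\rm c}$ is the set of convex elements. An element $x$ is invertible if there is $x'\in X$ with $x+x'=\theta$; $X^{\rm inv}$ is the set of invertible elements. Standing assumption: $X^{\rm inv}\cap X^{\rm c}\ne\{\theta\}$. $X$ is equipped with a fixed convexifying operator $P$: a surjection $P\colon X\to X^{\rm c}$ with $h_X(P(x),P(y))\le h_X(x,y)$, $P\circ P=P$, $P(\alpha x+\beta y)=\alpha P(x)+\beta P(y)$ for all $x,y\in X$, $\alpha,\beta\in\mathbb R$. Integral: for a simple mapping $f$ taking values $f_1,\dots,f_n$ on pairwise disjoint measurable sets $T_1,\dots,T_n$, $\int f(s)\,ds:=\sum_iP(f_i)\mu(T_i)$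 ($\mu$ the Lebesgue measure); for a uniform limit $f$ of simple mappings $f^k$ (in particular for continuous $f$), $\int f:=\lim_k\int f^k$. $H^\omega([a,b],X)$ is the class of $f\colon[a,b]\to X$ with $h_X(f(t'),f(t''))\le\omega(|t'-t''|)$ for all $t',t''\in[a,b]$. *)

(* Defs.v *)
From HB Require Import structures.
From mathcomp Require Import all_boot all_order all_algebra.
From mathcomp Require Import all_classical all_reals all_analysis.
Set Implicit Arguments.
Unset Strict Implicit.
Unset Printing Implicit Defensive.
Import Order.TTheory GRing.Theory Num.Theory.
Import numFieldTopology.Exports numFieldNormedType.Exports.
Local Open Scope classical_set_scope.
Local Open Scope ring_scope.

(* A semilinear space is not a (semi)module: (a + b) x = a x + b x may fail.
   It carries its own addition because the library's hierarchy offers no join of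
   [Nmodule] and [Metric]. *)
HB.mixin Record isSemilinear (R : numDomainType) X := {
  theta : X ;
  sadd : X -> X -> X ;
  sscale : R -> X -> X ;
  saddC : forall x y, sadd x y = sadd y x ;
  saddA : forall x y z, sadd x (sadd y z) = sadd (sadd x y) z ;
  saddr0 : forall x, sadd x theta = x ;
  sscaleDr : forall a x y, sscale a (sadd x y) = sadd (sscale a x) (sscale a y) ;
  sscaleA : forall a b x, sscale a (sscale b x) = sscale (a * b) x ;
  sscale1 : forall x, sscale 1 x = x ;
  sscale0 : forall x, sscale 0 x = theta
}.

#[short(type="semilinearType")]
HB.structure Definition Semilinear (R : numDomainType) :=
  {X of isSemilinear R X}.

Arguments theta {R s}.
Arguments sadd {R s}.

Declare Scope semilinear_scope.
Delimit Scope semilinear_scope with SL.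
Notation "x + y" := (sadd x y) : semilinear_scope.
Notation "a *: x" := (sscale a x) : semilinear_scope.
Notation "\sum_ ( i < n ) F" := (\big[sadd/theta]_(i < n) F%SL) :
  semilinear_scope.

Section SaddMonoid.
Context {R : numDomainType} {X : semilinearType R}.

Lemma sadd0r : left_id (theta : X) sadd.
Proof. by move=> x; rewrite saddC saddr0. Qed.

HB.instance Definition _ :=
  Monoid.isComLaw.Build X theta sadd saddA saddC sadd0r.

End SaddMonoid.

(* The base point required by [Complete] is irrelevant. *)
HB.mixin Record Semilinear_isLSpace (R : realType) X
    & Semilinear R X & Metric R X & Complete X := {
  lspace_separable : exists2 S : set X, countable S & dense S ;
  mdist_sscale : forall (a : R) (x y : X),
    mdist (a *: x)%SL (a *: y)%SL = `|a| * mdist x y ;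
  mdist_sadd_le : forall x y z : X, mdist (x + z)%SL (y + z)%SL <= mdist x y
}.

#[short(type="LSpaceType")]
HB.structure Definition LSpace (R : realType) :=
  {X of Semilinear R X & Metric R X & Complete X & Semilinear_isLSpace R X}.

Section LSpaceDefs.
Context {R : realType} {X : LSpaceType R}.
Implicit Types (P : X -> X) (f g : R -> X) (w : R -> R).

Definition convex_elements : set X :=
  [set x | forall a b : R, 0 <= a -> 0 <= b -> ((a + b)%R *: x = a *: x + b *: x)%SL].

Definition invertible_elements : set X := [set x | exists x', (x + x' = theta)%SL].

Record convexifying P : Prop := Convexifying {
  convexifying_range : range P = convex_elements ;
  convexifying_mdist : forall x y, mdist (P x) (P y) <= mdist x y ;
  convexifying_idem : forall x, P (P x) = P x ;
  convexifying_linear : forall (a b : R) x y,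
    (P (a *: x + b *: y) = a *: P x + b *: P y)%SL
}.

(* [.-cara.-measurable] for the outer measure of the interval length is
   measurability in the sense of Lebesgue (not only of Borel). *)
Definition lebesgue_measurable (A : set R) : Prop :=
  ((wlength (R := R) idfun)^*)%mu.-cara.-measurable A.

Definition simple_integral P (D : set R) f (y : X) : Prop :=
  exists (n : nat) (T : 'I_n -> set R) (v : 'I_n -> X),
  [/\ forall i, lebesgue_measurable (T i),
      trivIset [set: 'I_n] T,
      \bigcup_i T i = D,
      forall i t, T i t -> f t = v i &
      y = (\sum_(i < n) (fine (completed_lebesgue_measure (T i)) *: P (v i)))%SL].

Definition is_integral P (D : set R) f (y : X) : Prop :=
  exists (g : nat -> R -> X) (s : nat -> X),
  [/\ forall k, simple_integral P D (g k) (s k),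
      {uniform D, g @ \oo --> f} &
      s @ \oo --> y].

(* [theta] is returned only when no integral exists, which never happens for a
   continuous f on a segment. *)
Definition Lintegral P (D : set R) f : X := xget theta [set y | is_integral P D f y].

Record modulus_of_continuity w : Prop := ModulusOfContinuity {
  modulus_ge0 : forall s : R, 0 <= s -> 0 <= w s ;
  modulus_nondecreasing : forall s t : R, 0 <= s -> s <= t -> w s <= w t ;
  modulus_continuous : {within `[0, +oo[, continuous w} ;
  modulus_semiadditive : forall s t : R, 0 <= s -> 0 <= t -> w (s + t) <= w s + w t ;
  modulus0 : w 0 = 0
}.

Definition concave_modulus w : Prop :=
  convex_function (E := R^o) `[0, +oo[ (\- w).

(* A map on [a, b] is represented by a total one; values off [a, b] play no
   role. *)
Definition H_class w (a b : R) : set (R -> X) :=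
  [set f | forall t1 t2, t1 \in `[a, b] -> t2 \in `[a, b] ->
    mdist (f t1) (f t2) <= w `|t1 - t2|].

End LSpaceDefs.

Arguments convex_elements {R} X.
Arguments invertible_elements {R} X.

Definition isotropic (R : realType) (X : LSpaceType R) : Prop :=
  forall x y z : X, mdist (x + z)%SL (y + z)%SL = mdist x y.

(* Main.v *)
(* Upper bound: part of the mass common to the two averages stays in place and the
   rest is moved by affine maps reversing the order, so that every point crosses
   the interface between excess and deficit and the distances travelled fill an
   interval; a move over distance s changes f by at most w s.  Averages are
   compared through uniform Riemann sums, on which the transport acts termwise.

   Sharpness: for concave w the dual (Kantorovich) potential is explicit.  It is
   piecewise a multiple of w composed with an affine map, is w-Lipschitz, and
   grows by exactly w s along each transported pair at distance s.  Multiplying it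
   by a convex element at distance 1 from theta gives an extremal f. *)

Require Import Defs.
From HB Require Import structures.
From mathcomp Require Import all_boot all_order all_algebra.
From mathcomp Require Import all_classical all_reals all_analysis.
From mathcomp Require Import ring lra.
Set Implicit Arguments.
Unset Strict Implicit.
Unset Printing Implicit Defensive.
Import Order.TTheory GRing.Theory Num.Theory.
Import numFieldTopology.Exports numFieldNormedType.Exports.
Local Open Scope classical_set_scope.
Local Open Scope ring_scope.

(** [X] has no subtraction, and (s + t) x = s x + t x is available only for convex x and s, t >= 0.
    So masses can be cut and merged only behind [P], and the common mass is split off as a summand
    ([z] in [transport_sharp]), which uses that integrals are themselves convex.

    The constants are mass balances. The densities 1/M and 1/m leave an excess on one side of the
    interface and a deficit on the other; equating the two up to a cut point [c'] produces M(b-c)/m,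
    M(c-a)/(M-m) and M(b-d)/(M-m) as largest distances travelled in a piece. Since both ends of a
    pair recede from the interface, moved mass has density 1/(1/rho + 1/sigma) in the distance: this
    is 1/(M+m) for 1/M against 1/m, and (M-m)/M^2 for 1/M against 1/m - 1/M.

    The potential comes from first-order optimality: formally, its slope at both ends of a pair at
    distance s is w'(s). In terms of s it is therefore w weighted by the speeds at which the ends
    recede. In the overlapping case these speeds jump where two pieces meet, and admissibility
    across the jump is the delicate inequality, [bent_cross]. *)

(** * Algebra and metric of L-spaces *)

Section LSpaceTheory.
Context {R : realType} {X : LSpaceType R}.
Implicit Types (x y z : X) (P : X -> X).

Lemma sscale_theta (a : R) : (a *: (theta : X))%SL = theta.
Proof. by rewrite -(sscale0 (theta : X)) sscaleA mulr0. Qed.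

Lemma mdist_sadd (x y z t : X) :
  mdist (x + y)%SL (z + t)%SL <= mdist x z + mdist y t.
Proof.
apply: (le_trans (metric_triangle _ (z + y)%SL _)); apply: lerD.
  exact: mdist_sadd_le.
by rewrite (saddC z) (saddC z); exact: mdist_sadd_le.
Qed.

Lemma mdist_big_sadd (I : Type) (r : seq I) (F G : I -> X) :
  mdist (\big[sadd/theta]_(i <- r) F i) (\big[sadd/theta]_(i <- r) G i) <=
  \sum_(i <- r) mdist (F i) (G i).
Proof.
elim: r => [|i r IHr]; first by rewrite !big_nil mdistxx.
by rewrite !big_cons (le_trans (mdist_sadd _ _ _ _))// lerD2l.
Qed.

Lemma mdist_sscale_pos (a : R) x y : 0 <= a ->
  mdist (a *: x)%SL (a *: y)%SL = a * mdist x y.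
Proof. by move=> a0; rewrite mdist_sscale ger0_norm. Qed.

Lemma sscale_big_sadd (I : Type) (r : seq I) (a : R) (F : I -> X) :
  (a *: (\big[sadd/theta]_(i <- r) F i))%SL =
  \big[sadd/theta]_(i <- r) (a *: F i)%SL.
Proof.
elim: r => [|i r IHr]; first by rewrite !big_nil sscale_theta.
by rewrite !big_cons sscaleDr IHr.
Qed.

Lemma convex_sscaleDl x (a b : R) : convex_elements X x -> 0 <= a -> 0 <= b ->
  ((a + b)%R *: x = a *: x + b *: x)%SL.
Proof. by move=> cx; exact: cx. Qed.

Lemma convex_sscale_suml x (I : Type) (r : seq I) (F : I -> R) :
    convex_elements X x -> (forall i, 0 <= F i) ->
  ((\sum_(i <- r) F i)%R *: x)%SL = \big[sadd/theta]_(i <- r) (F i *: x)%SL.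
Proof.
move=> cx F0; elim: r => [|i r IHr]; first by rewrite !big_nil sscale0.
by rewrite !big_cons convex_sscaleDl ?IHr// sumr_ge0.
Qed.

Lemma convex_sscale x (a : R) : convex_elements X x ->
  convex_elements X (a *: x)%SL.
Proof.
move=> cx s t s0 t0.
by rewrite sscaleA mulrC -sscaleA cx// sscaleDr !sscaleA ![a * _]mulrC.
Qed.

Section Convexifying.
Variables (P : X -> X) (hP : convexifying P).

Lemma convexifying_convex x : convex_elements X (P x).
Proof. by rewrite -(convexifying_range hP); exists x. Qed.

Lemma convexifying_id x : convex_elements X x -> P x = x.
Proof.
by rewrite -(convexifying_range hP) => -[y _ <-]; exact: convexifying_idem.
Qed.

End Convexifying.

End LSpaceTheory.

(** * Additivity of Lebesgue measure over finite partitions *)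

Section LebesgueMeasurable.
Context {R : realType}.
Implicit Types (A B : set R).
Local Notation mu := (@completed_lebesgue_measure R).

Lemma lebesgue_measurableI A B :
  lebesgue_measurable A -> lebesgue_measurable B -> lebesgue_measurable (A `&` B).
Proof. exact: caratheodory_measurable_setI. Qed.

Lemma lebesgue_measurable_itv (i : interval R) : lebesgue_measurable [set` i].
Proof. by apply: sub_caratheodory; exact: measurable_itv. Qed.

Lemma fine_completed_lebesgue_ge0 A : 0 <= fine (mu A).
Proof. by rewrite fine_ge0. Qed.

Lemma fine_completed_lebesgue_partition (D : set R) n (T : 'I_n -> set R) A :
    (mu D < +oo)%E -> A `<=` D -> lebesgue_measurable A ->
    lebesgue_measurable D ->
    (forall i, lebesgue_measurable (T i)) -> trivIset [set: 'I_n] T ->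
    \bigcup_i T i = D ->
  fine (mu A) = \sum_(i < n) fine (mu (A `&` T i)).
Proof.
move=> Dfin AD mA mD mT tT UT.
have mAT i : lebesgue_measurable (A `&` T i) by exact: lebesgue_measurableI.
have {1}-> : A = \big[setU/set0]_(i < n) (A `&` T i).
  rewrite -bigcup_seq eqEsubset; split=> t; last by move=> [i _ []].
  move=> At; have [i _ Ti] : (\bigcup_i T i) t by rewrite UT; exact: AD.
  by exists i => //=; rewrite mem_index_enum.
rewrite measure_bigsetU_ord//; last exact: trivIset_setIl.
rewrite -sum_fine// => i _; rewrite ge0_fin_numE//; apply: le_lt_trans Dfin.
by apply: le_measure; rewrite ?inE; [exact: mAT|exact: mD|move=> t [/AD]].
Qed.

End LebesgueMeasurable.

(** * The integral: comparison estimate and existence *)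

Section Integral.
Context {R : realType} {X : LSpaceType R}.
Variables (P : X -> X) (hP : convexifying P).
Implicit Types (D : set R) (f g : R -> X) (x y z : X).
Local Notation mu := (@completed_lebesgue_measure R).

Lemma simple_integral_measurable D f y :
  simple_integral P D f y -> lebesgue_measurable D.
Proof.
move=> [n [T [v [mT _ <- _ _]]]]; rewrite (_ : \bigcup_i T i =
    \big[setU/set0]_(i < n) T i).
  by elim/big_ind : _ => //; [exact: caratheodory_measurable_set0
    |exact: caratheodory_measurable_setU].
rewrite -bigcup_seq eqEsubset; split => t [i _ Ti]; exists i => //=.
by rewrite mem_index_enum.
Qed.

(** Splitting the measure of a cell under the scalar multiplication is legitimate because the values
    of [P] are convex. *)
Lemma simple_integral_refine D n m (T : 'I_n -> set R) (S : 'I_m -> set R)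
    (v : 'I_n -> X) : (mu D < +oo)%E -> lebesgue_measurable D ->
    (forall i, lebesgue_measurable (T i)) ->
    (forall j, lebesgue_measurable (S j)) ->
    \bigcup_i T i = D -> \bigcup_j S j = D -> trivIset [set: 'I_m] S ->
  \big[sadd/theta]_(i < n) (fine (mu (T i)) *: P (v i))%SL =
  \big[sadd/theta]_(i < n) \big[sadd/theta]_(j < m)
    (fine (mu (T i `&` S j)) *: P (v i))%SL.
Proof.
move=> Dfin mD mT mS UT US tS; apply: eq_bigr => i _.
have TD : T i `<=` D by rewrite -UT => t Ti; exists i.
rewrite (fine_completed_lebesgue_partition Dfin TD (mT i) mD mS tS US).
apply: convex_sscale_suml; first exact: (convexifying_convex hP).
by move=> j; exact: fine_completed_lebesgue_ge0.
Qed.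

Lemma mdist_simple_integral D f g y z (e : R) :
    (mu D < +oo)%E -> simple_integral P D f y -> simple_integral P D g z ->
    (forall t, D t -> mdist (f t) (g t) <= e) ->
  mdist y z <= e * fine (mu D).
Proof.
move=> Dfin fy gz fge; have mD := simple_integral_measurable fy.
move: fy gz => [n [T [v [mT tT UT fT ->]]]] [m [S [u [mS tS US gS ->]]]].
rewrite (simple_integral_refine v Dfin mD mT mS UT US tS).
rewrite (simple_integral_refine u Dfin mD mS mT US UT tT).
rewrite [X in mdist _ X]exchange_big/=.
rewrite (fine_completed_lebesgue_partition Dfin (@subset_refl _ D) mD mD mT tT UT).
rewrite mulr_sumr (le_trans (mdist_big_sadd _ _ _))//.
apply: ler_sum => i _; rewrite (le_trans (mdist_big_sadd _ _ _))//.
have TD : T i `<=` D by rewrite -UT => t Ti; exists i.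
rewrite (_ : D `&` T i = T i); last by rewrite setIC; exact/setIidPl.
rewrite (fine_completed_lebesgue_partition Dfin TD (mT i) mD mS tS US).
rewrite mulr_sumr; apply: ler_sum => j _.
rewrite (setIC (S j)).
(* On an empty cell the two values are unrelated, but its measure is zero. *)
have [->|/set0P[t [Tt St]]] := eqVneq (T i `&` S j) set0.
  by rewrite measure0 !sscale0 mdistxx mulr0.
rewrite mdist_sscale_pos ?fine_completed_lebesgue_ge0// mulrC.
rewrite ler_wpM2r ?fine_completed_lebesgue_ge0//.
rewrite (le_trans (convexifying_mdist hP _ _))//.
by rewrite -(fT i t)// -(gS j t)//; apply: fge; exact: TD.
Qed.

Lemma mdist_cvg (u : nat -> X) (l : X) :
  u @ \oo --> l <-> (fun n => mdist l (u n)) @ \oo --> (0 : R).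
Proof.
split=> [ul|ul].
- apply/cvgrPdist_le => e e0.
  move/metricType_numDomainType.cvgrPdist_le : ul => /(_ _ e0); apply: filterS => n.
  by rewrite sub0r normrN ger0_norm ?mdist_ge0.
- apply/metricType_numDomainType.cvgrPdist_le => e e0.
  move/cvgrPdist_le : ul => /(_ _ e0); apply: filterS => n.
  by rewrite sub0r normrN ger0_norm ?mdist_ge0.
Qed.

Lemma uniform_mdistP D (u : nat -> R -> X) f :
  {uniform D, u @ \oo --> f} <->
  forall e : R, 0 < e -> \forall n \near \oo,
    forall t, D t -> mdist (f t) (u n t) < e.
Proof.
split=> [uf e e0|uf].
- have : nbhs (f : {uniform` D -> X})
      [set h : {uniform` D -> X} | forall t, D t -> mdist (f t) (h t) < e].
    apply/uniform_nbhs; exists [set xy | ball xy.1 e xy.2]; split => //=.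
      exact: (entourage_ball _ (PosNum e0)).
    by move=> h fh t /fh; rewrite ballEmdist.
  by move=> /uf.
- move=> A /uniform_nbhs[E [/= + EA]]; rewrite -entourage_ballE => -[e /= e0 eE].
  have := uf _ e0; apply: filterS => n ne; apply: EA => t Dt; apply: eE => /=.
  by rewrite ballEmdist; exact: ne.
Qed.

Lemma mdist_is_integral D f g y z (e : R) :
    (mu D < +oo)%E -> is_integral P D f y -> simple_integral P D g z ->
    (forall t, D t -> mdist (f t) (g t) <= e) ->
  mdist y z <= e * fine (mu D).
Proof.
move=> Dfin [u [s [us /uniform_mdistP uf /mdist_cvg sy]]] gz fge.
apply/ler_addgt0Pr => d d0.
(* Half of [d] pays for [s n] against [y], the other half for the uniform error spread over [D]; the
   + 1 keeps the denominator positive when [D] is null. *)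
pose d' := d / 2 / (fine (mu D) + 1).
have mu1 : 0 < fine (mu D) + 1.
  by rewrite ltr_wpDl// fine_completed_lebesgue_ge0.
have d'0 : 0 < d' by rewrite divr_gt0 ?divr_gt0.
have /cvgrPdist_le/(_ (d / 2)) := sy; rewrite divr_gt0// => /(_ isT) syd.
near \oo => n.
have ysn : mdist y (s n) <= d / 2.
  by rewrite (le_trans (ler_norm _))// -normrN -sub0r; near: n.
have snz : mdist (s n) z <= (e + d') * fine (mu D).
  apply: (mdist_simple_integral Dfin (us n) gz) => t Dt.
  rewrite (le_trans (metric_triangle _ (f t) _))// addrC lerD ?fge//.
  rewrite metric_sym ltW//; move: t Dt; near: n; exact: uf.
rewrite (le_trans (metric_triangle _ (s n) _))//.
rewrite (le_trans (lerD ysn snz))// mulrDl addrCA lerD2l.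
rewrite [leRHS]splitr lerD2l /d' mulrAC ler_pdivrMr//.
by rewrite ler_pM2l ?divr_gt0// lerDl.
Unshelve. all: by end_near. Qed.

Lemma is_integral_exists D f : (mu D < +oo)%E ->
    (forall e : R, 0 < e -> exists g s, simple_integral P D g s /\
      forall t, D t -> mdist (f t) (g t) <= e) ->
  exists y, is_integral P D f y.
Proof.
move=> Dfin fa.
have /choice[g /choice[s gs]] : forall n, exists g s, simple_integral P D g s /\
    forall t, D t -> mdist (f t) (g t) <= (n.+1%:R^-1 : R).
  by move=> n; apply: fa; rewrite invr_gt0.
have ug : {uniform D, g @ \oo --> f}.
  apply/uniform_mdistP => e e0; near=> n => t Dt.
  rewrite (le_lt_trans ((gs n).2 _ Dt))//; near: n.
  exact: (near_infty_natSinv_lt (PosNum e0)).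
suff : cvg (s @ \oo) by move=> /cvg_ex[y sy]; exists y, g, s; split=> // n;
  have [] := gs n.
apply/cauchy_cvgP/cauchy_ballP => e e0.
have mu1 : 0 < fine (mu D) + 1.
  by rewrite ltr_wpDl// fine_completed_lebesgue_ge0.
pose d := e / 2 / (fine (mu D) + 1).
have d0 : 0 < d by rewrite !divr_gt0.
have [N _ Nd] := near_infty_natSinv_lt (PosNum d0).
exists ([set s n | n in [set n | (N <= n)%N]], [set s n | n in [set n | (N <= n)%N]]) => /=.
  by split; exists N => // n Nn; exists n.
move=> [_ _] /= [[n Nn <-] [m Nm <-]]; rewrite ballEmdist/=.
rewrite (@le_lt_trans _ _ ((d + d) * fine (mu D)))//.
  apply: (mdist_simple_integral Dfin (gs n).1 (gs m).1) => t Dt.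
  rewrite (le_trans (metric_triangle _ (f t) _))// lerD//.
    by rewrite metric_sym (le_trans ((gs n).2 _ Dt))// ltW// Nd.
  by rewrite (le_trans ((gs m).2 _ Dt))// ltW// Nd.
have -> : (d + d) = e / (fine (mu D) + 1) by rewrite /d; field; rewrite gt_eqF.
by rewrite mulrAC ltr_pdivrMr// ltr_pM2l// ltrDl.
Unshelve. all: by end_near. Qed.

Lemma Lintegral_is_integral D f : (exists y, is_integral P D f y) ->
  is_integral P D f (Lintegral P D f).
Proof. by move=> fy; exact: (xgetPex theta fy). Qed.

End Integral.

(** * Riemann sums over partitions of a segment *)

Section Partition.
Context {R : realType} {X : LSpaceType R}.
Variables (P : X -> X) (hP : convexifying P).
Implicit Types (f g : R -> X) (t : nat -> R) (w : R -> R).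
Local Notation mu := (@completed_lebesgue_measure R).

Lemma completed_lebesgue_measure_itv (b1 b2 : bool) (x y : R) : x <= y ->
  mu [set` Interval (BSide b1 x) (BSide b2 y)] = (y - x)%:E.
Proof.
move=> xy; rewrite [LHS](lebesgue_measure_itv (Interval (BSide b1 x) (BSide b2 y))).
rewrite /= lte_fin lt_neqAle xy andbT; case: eqVneq => [->|//].
by rewrite subrr.
Qed.

Lemma partition_homo t n : (forall i, (i < n)%N -> t i <= t i.+1) ->
  forall i j, (i <= j)%N -> (j <= n)%N -> t i <= t j.
Proof.
move=> tle i; elim=> [|j IHj]; first by rewrite leqn0 => /eqP ->.
rewrite leq_eqVlt => /predU1P[->//|]; rewrite ltnS => ij jn.
by rewrite (le_trans (IHj ij (ltnW jn)))// tle.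
Qed.

Lemma partition_cell t n (u : R) : t 0%N < u -> u <= t n ->
  exists2 i, (i < n)%N & t i < u <= t i.+1.
Proof.
move=> t0u; elim: n => [|n IHn] utn.
  by move: t0u; rewrite ltNge utn.
have [/IHn[i ni iu]|tnu] := leP u (t n); first by exists i => //; exact: ltnW.
by exists n => //; rewrite tnu.
Qed.

Lemma partition_simple_integral f t n (v : nat -> X) (e : R) : 0 <= e ->
    (forall i, (i < n)%N -> t i <= t i.+1) ->
    (forall i u, (i < n)%N -> t i <= u <= t i.+1 -> mdist (f u) (v i) <= e) ->
  exists2 g, simple_integral P `[t 0%N, t n] g
      (\big[sadd/theta]_(i < n) ((t i.+1 - t i)%R *: P (v i))%SL) &
    forall u, u \in `[t 0%N, t n] -> mdist (f u) (g u) <= e.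
Proof.
move=> e0 tle fv; have tmono := partition_homo tle.
(* Half-open cells are disjoint even at the nodes. The left end becomes a cell of its own, of
   measure zero, so indices shift by one. *)
pose T (i : 'I_n.+1) : set R :=
  if i == ord0 then `[t 0%N, t 0%N]%classic else `]t i.-1, t i]%classic.
pose vv (i : 'I_n.+1) : X := if i == ord0 then f (t 0%N) else v i.-1.
pose g (u : R) : X := if pselect (exists i, T i u) is left h
  then vv (projT1 (cid h)) else theta.
have Tle i u : T i u -> u <= t i.
  rewrite /T; case: eqVneq => [->|_] /=; rewrite in_itv/= => /andP[]//.
have Tge (i j : 'I_n.+1) u : (i < j)%N -> T j u -> t i < u.
  case: i j => [i ni] [[//|j] nj] /= ij; rewrite /T /= in_itv/= => /andP[tj _].
  by rewrite (le_lt_trans _ tj)// tmono// ltnW.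
have tT : trivIset [set: 'I_n.+1] T.
  move=> i j _ _ [u [Ti Tj]]; apply/val_inj; case: (ltngtP i j) => // ij.
  - by have := Tge _ _ _ ij Tj; rewrite ltNge Tle.
  - by have := Tge _ _ _ ij Ti; rewrite ltNge Tle.
have gT i u : T i u -> g u = vv i.
  rewrite /g => Tiu; case: pselect => [h|[]]; last by exists i.
  by case: cid => j Tj /=; congr vv; apply: tT => //; exists u.
have UT : \bigcup_i T i = `[t 0%N, t n]%classic.
  rewrite eqEsubset; split => u /=.
    move=> [i _]; rewrite /T; case: eqVneq => [_|i0] /=; rewrite !in_itv/=.
      by move=> /andP[-> ut0]; rewrite (le_trans ut0)// tmono.
    have i1 : (0 < i)%N by rewrite lt0n.
    have iln : (i <= n)%N by rewrite -ltnS.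
    move=> /andP[iu ui]; apply/andP; split.
      apply: le_trans (ltW iu); apply: tmono => //.
      by rewrite (leq_trans (leq_pred _)).
    by apply: le_trans ui _; exact: tmono.
  rewrite in_itv/= le_eqVlt => /andP[/predU1P[<- _|t0u utn]].
    by exists ord0 => //; rewrite /T eqxx/= in_itv/= lexx.
  have [i ni tiu] := partition_cell t0u utn.
  by exists (lift ord0 (Ordinal ni)).
exists g; last first.
  move=> u utn; have [i _ Ti] : (\bigcup_i T i) u by rewrite UT.
  rewrite (gT _ _ Ti) /vv.
  move: Ti; rewrite /T; case: eqVneq => [_|i0] /=; rewrite in_itv/=.
    by rewrite -eq_le => /eqP ->; rewrite mdistxx.
  have i1 : (0 < i)%N by rewrite lt0n.
  have iln : (i <= n)%N by rewrite -ltnS.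
  by move=> /andP[iu ui]; apply: fv; rewrite prednK// ui ltW.
exists n.+1, T, vv; split => //.
  by move=> i; rewrite /T; case: eqVneq => _; exact: lebesgue_measurable_itv.
rewrite big_ord_recl/= /T eqxx completed_lebesgue_measure_itv//= subrr sscale0.
rewrite sadd0r; apply: eq_bigr => i _ /=.
by rewrite completed_lebesgue_measure_itv /bump/= ?add0n ?add1n ?tle.
Qed.

(** The tags [v i] are arbitrary and the cells may be unequal: this covers sampling at left or right
    endpoints as well as concatenated grids. *)
Lemma mdist_Lintegral_partition f t n (v : nat -> X) (e : R) : 0 <= e ->
    (exists y, is_integral P `[t 0%N, t n] f y) ->
    (forall i, (i < n)%N -> t i <= t i.+1) ->
    (forall i u, (i < n)%N -> t i <= u <= t i.+1 -> mdist (f u) (v i) <= e) ->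
  mdist (Lintegral P `[t 0%N, t n] f)
    (\big[sadd/theta]_(i < n) ((t i.+1 - t i)%R *: P (v i))%SL) <=
  e * (t n - t 0%N).
Proof.
move=> e0 /Lintegral_is_integral fI tle fv.
have t0n : t 0%N <= t n by exact: partition_homo tle _ _ _ _.
have [g gI fg] := partition_simple_integral e0 tle fv.
have mufin : (mu `[t 0%N, t n] < +oo)%E.
  by rewrite completed_lebesgue_measure_itv// ltry.
have := mdist_is_integral hP mufin fI gI fg.
by rewrite completed_lebesgue_measure_itv.
Qed.

End Partition.

(** * Moduli of continuity and uniform grids *)

Section Modulus.
Context {R : realType}.
Variables (w : R -> R) (hw : modulus_of_continuity w).

Lemma modulus_cvg0 (u : nat -> R) : (forall n, 0 <= u n) ->
  u @ \oo --> 0 -> (w \o u) @ \oo --> 0.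
Proof.
move=> u0 uc; apply/cvgrPdist_lt => e e0.
have := modulus_continuous hw => /subspace_continuousP/(_ 0).
rewrite /= in_itv/= lexx => /(_ isT).
move=> /cvgrPdist_lt/(_ _ e0) we.
have [N _ Nu] := uc _ we; exists N => // n /Nu /=.
by rewrite in_itv/= u0 /from_subspace (modulus0 hw) => /(_ isT).
Qed.

(** For [y < x] the nodes run backwards. An affine map between two segments thus carries node [i] to
    node [i] even when it reverses the order. *)
Definition grid (x y : R) (n i : nat) : R := x + i%:R / n%:R * (y - x).

Lemma grid0 x y n : grid x y n 0 = x.
Proof. by rewrite /grid mul0r mul0r addr0. Qed.

Lemma gridn x y n : grid x y n.+1 n.+1 = y.
Proof. by rewrite /grid divff// mul1r addrC subrK. Qed.

Lemma gridS x y n i : grid x y n i.+1 - grid x y n i = (y - x) / n%:R.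
Proof. by rewrite /grid -natr1; ring. Qed.

Lemma grid_le x y n i : x <= y -> grid x y n i <= grid x y n i.+1.
Proof. by move=> xy; rewrite -subr_ge0 gridS divr_ge0// subr_ge0. Qed.

Lemma grid_homo x y n i j : x <= y -> (i <= j)%N -> grid x y n i <= grid x y n j.
Proof.
move=> xy ij.
by apply: (@partition_homo _ (grid x y n) j) => // k _; exact: grid_le.
Qed.

Lemma grid_cvg0 (l : R) : 0 <= l -> (fun n => w (l / n.+1%:R)) @ \oo --> 0.
Proof.
move=> l0; apply: (@modulus_cvg0 (fun n => l / n.+1%:R)).
  by move=> n; rewrite divr_ge0.
rewrite -[X in _ --> X](mulr0 l); apply: cvgMr.
exact: cvg_harmonic.
Qed.

End Modulus.

(** * Uniform means in X approximating the integral *)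

Section Mean.
Context {R : realType} {X : LSpaceType R}.
Variables (P : X -> X) (hP : convexifying P).
Variables (w : R -> R) (hw : modulus_of_continuity w).
Implicit Types (f g : R -> X) (x y z : R).

Lemma mdist_eq_cvg0 (y z : X) (u : nat -> R) :
  (forall n, mdist y z <= u n) -> u @ \oo --> 0 -> y = z.
Proof.
move=> yz u0; apply: mdist_positivity; apply/eqP.
rewrite eq_le mdist_ge0 andbT.
by apply: (ler_cvg_to (@cvg_cst _ (mdist y z) _ _ _) u0); apply: nearW.
Qed.

Lemma H_class_subitv f x y z t : H_class w x y f -> x <= z -> t <= y ->
  H_class w z t f.
Proof.
move=> fH xz ty s1 s2; rewrite !in_itv/= => /andP[zs1 s1t] /andP[zs2 s2t].
by apply: fH; rewrite in_itv/= ?(le_trans xz)// (le_trans _ ty).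
Qed.

Lemma modulus_norm_le (d e : R) : `|d| <= e -> w `|d| <= w e.
Proof. by move=> de; exact: (modulus_nondecreasing hw). Qed.

Lemma norm_cell_le (d u v e : R) : d <= u -> u <= e -> d <= v -> v <= e ->
  `|u - v| <= e - d.
Proof. by move=> du ue dv ve; rewrite ler_norml; apply/andP; split; lra. Qed.

Lemma grid_in x y n i : x <= y -> (i <= n.+1)%N -> x <= grid x y n.+1 i <= y.
Proof.
move=> xy ni; apply/andP; split.
  by rewrite -[leLHS](grid0 x y n.+1) grid_homo.
by rewrite -[leRHS](gridn x y n) grid_homo.
Qed.

Lemma H_class_cell f x y n i (u v : R) : H_class w x y f -> x <= y ->
    (i < n.+1)%N ->
    grid x y n.+1 i <= u <= grid x y n.+1 i.+1 ->
    grid x y n.+1 i <= v <= grid x y n.+1 i.+1 ->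
  mdist (f u) (f v) <= w ((y - x) / n.+1%:R).
Proof.
move=> fH xy ni /andP[iu ui] /andP[iv vi].
have /andP[xi _] := grid_in xy (ltnW ni).
have /andP[_ iy] := grid_in xy ni.
apply: le_trans (fH _ _ _ _) _; rewrite ?in_itv/=.
- by rewrite (le_trans xi)// (le_trans ui).
- by rewrite (le_trans xi)// (le_trans vi).
- by rewrite -(gridS _ _ _ i) modulus_norm_le// norm_cell_le.
Qed.

Lemma modulus_grid_ge0 x y n : x <= y -> 0 <= w ((y - x) / n.+1%:R).
Proof. by move=> xy; apply: (modulus_ge0 hw); rewrite divr_ge0// subr_ge0. Qed.

Lemma H_class_integral f x y : H_class w x y f -> x <= y ->
  exists I, is_integral P `[x, y] f I.
Proof.
move=> fH xy; apply: is_integral_exists => // [|e e0].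
  by rewrite completed_lebesgue_measure_itv// ltry.
have yx0 : 0 <= y - x by rewrite subr_ge0.
have /cvgrPdist_le/(_ _ e0)[n _ /(_ n (leqnn n))/=] := grid_cvg0 hw yx0.
rewrite sub0r normrN ger0_norm ?modulus_grid_ge0// => wne.
have := @partition_simple_integral R X P f (grid x y n.+1) n.+1
  (fun i => f (grid x y n.+1 i)) e (ltW e0).
rewrite grid0 gridn => -[||g gI fg]; last by exists g; eexists; split; [exact: gI|].
- by move=> i _; exact: grid_le.
- move=> i u ni iu; rewrite (le_trans _ wne)//; apply: H_class_cell ni iu _ => //.
  by rewrite lexx grid_le.
Qed.

(** Node [n] is left out: each cell is sampled at the end met first on the way from [x] to [y]. *)
Definition mean n f x y : X :=
  \big[sadd/theta]_(i < n) (n%:R^-1 *: P (f (grid x y n i)))%SL.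

Lemma sscale_mean (l : R) n f x y : 0 <= l ->
  (l *: mean n f x y)%SL =
  \big[sadd/theta]_(i < n) ((l / n%:R)%R *: P (f (grid x y n i)))%SL.
Proof.
by move=> l0; rewrite sscale_big_sadd; apply: eq_bigr => i _; rewrite sscaleA.
Qed.

Lemma grid_rev x y n i : (i <= n.+1)%N ->
  grid x y n.+1 (n.+1 - i) = grid y x n.+1 i.
Proof.
move=> ni; rewrite /grid natrB//; field.
by rewrite addrC natr1 pnatr_eq0.
Qed.

Lemma mdist_Lintegral_mean f x y n : H_class w x y f -> x <= y ->
  mdist (Lintegral P `[x, y] f) ((y - x) *: mean n.+1 f x y)%SL <=
  w ((y - x) / n.+1%:R) * (y - x).
Proof.
move=> fH xy; rewrite sscale_mean ?subr_ge0//.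
have := @mdist_Lintegral_partition R X P hP f (grid x y n.+1) n.+1
  (fun i => f (grid x y n.+1 i)) _ (modulus_grid_ge0 n xy).
rewrite grid0 gridn; under eq_bigr do rewrite gridS; apply.
- exact: H_class_integral.
- by move=> i _; exact: grid_le.
- by move=> i u ni iu; apply: H_class_cell ni iu _ => //; rewrite lexx grid_le.
Qed.

(** Run backwards, the sampled nodes are the right endpoints of the cells, which is just another
    choice of tags. *)
Lemma mdist_Lintegral_mean_rev f x y n : H_class w x y f -> x <= y ->
  mdist (Lintegral P `[x, y] f) ((y - x) *: mean n.+1 f y x)%SL <=
  w ((y - x) / n.+1%:R) * (y - x).
Proof.
move=> fH xy; rewrite sscale_mean ?subr_ge0//.
have := @mdist_Lintegral_partition R X P hP f (grid x y n.+1) n.+1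
  (fun i => f (grid x y n.+1 i.+1)) _ (modulus_grid_ge0 n xy).
rewrite grid0 gridn; under eq_bigr do rewrite gridS.
rewrite (reindex_inj rev_ord_inj)/= => /(_ (H_class_integral fH xy)).
under eq_bigr => i _.
  rewrite subSS -subSn -1?ltnS// grid_rev; last exact: ltnW (ltn_ord i).
  over.
apply.
- by move=> i _; exact: grid_le.
- by move=> i u ni iu; apply: H_class_cell ni iu _ => //; rewrite lexx grid_le.
Qed.

(** [Lintegral] chooses its values on the three segments independently; they are tied together by
    the Riemann sums of one partition having [z] as a node. *)
Lemma Lintegral_split f x y z : H_class w x y f -> x <= z -> z <= y ->
  (Lintegral P `[x, y] f = Lintegral P `[x, z] f + Lintegral P `[z, y] f)%SL.
Proof.
move=> fH xz zy; have xy := le_trans xz zy.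
have fxz := H_class_subitv fH (lexx x) zy.
have fzy := H_class_subitv fH xz (lexx y).
pose e n := w ((z - x) / n.+1%:R) + w ((y - z) / n.+1%:R).
have yx0 : 0 <= y - x by rewrite subr_ge0.
have zx0 : 0 <= z - x by rewrite subr_ge0.
have yz0 : 0 <= y - z by rewrite subr_ge0.
apply: (@mdist_eq_cvg0 _ _ (fun n => e n * (y - x) +
  (w ((z - x) / n.+1%:R) * (z - x) + w ((y - z) / n.+1%:R) * (y - z)))); last first.
  rewrite -[X in _ --> X]addr0; apply: cvgD.
    rewrite -(mul0r (y - x)); apply: cvgMl; rewrite -[X in _ --> X]addr0.
    by apply: cvgD; exact: grid_cvg0.
  rewrite -[X in _ --> X]addr0; apply: cvgD.
    by rewrite -(mul0r (z - x)); apply: cvgMl; exact: grid_cvg0.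
  by rewrite -(mul0r (y - z)); apply: cvgMl; exact: grid_cvg0.
move=> n; rewrite (le_trans (metric_triangle _ ((z - x) *: mean n.+1 f x z +
  (y - z) *: mean n.+1 f z y)%SL _))//; apply: lerD; last first.
  rewrite (le_trans (mdist_sadd _ _ _ _))//.
  rewrite metric_sym (metric_sym _ (Lintegral P `[z, y] f)).
  by rewrite lerD// mdist_Lintegral_mean.
(* Two grids of [n.+1] cells joined at [z]; their meshes differ, which is why [e] adds both
   moduli. *)
pose t i := if (i < n.+1)%N then grid x z n.+1 i else grid z y n.+1 (i - n.+1).
have t0 : t 0%N = x by rewrite /t/= grid0.
have tn : t (n.+1 + n.+1)%N = y by rewrite /t ltnNge leq_addr/= addnK gridn.
have tl i : (i < n.+1)%N -> t i = grid x z n.+1 i by rewrite /t => ->.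
have tlS i : (i < n.+1)%N -> t i.+1 = grid x z n.+1 i.+1.
  rewrite leq_eqVlt => /predU1P[[->]|/tl //].
  by rewrite /t ltnn subnn grid0 gridn.
have tr i : t (n.+1 + i)%N = grid z y n.+1 i.
  by rewrite /t ltnNge leq_addr/= addKn.
have e0 : 0 <= e n by rewrite addr_ge0// modulus_grid_ge0.
have := @mdist_Lintegral_partition R X P hP f t (n.+1 + n.+1) (f \o t) _ e0.
rewrite t0 tn big_split_ord/= !sscale_mean//.
under eq_bigr => i _ do rewrite tlS// tl// gridS.
under [X in (_ + X)%SL]eq_bigr => i _ do rewrite -addnS !tr gridS.
apply.
- exact: H_class_integral.
- move=> i _; have [ni|ni] := ltnP i n.+1; first by rewrite tl// tlS// grid_le.
  by rewrite -(subnKC ni) -addnS !tr grid_le.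
- move=> i u i2; have [ni|ni] := ltnP i n.+1.
    rewrite tl// tlS// => iu; rewrite (@le_trans _ _ (w ((z - x) / n.+1%:R)))//.
      by apply: H_class_cell ni iu _ => //; rewrite lexx grid_le.
    by rewrite lerDl modulus_grid_ge0.
  move: i2; rewrite -(subnKC ni) ltn_add2l -addnS !tr => i2 iu.
  rewrite (@le_trans _ _ (w ((y - z) / n.+1%:R)))//.
    by apply: H_class_cell i2 iu _ => //; rewrite lexx grid_le.
  by rewrite lerDr modulus_grid_ge0.
Qed.

(** Riemann sums are built from multiples of values of [P], hence convex, and the identity survives
    the limit. This lets the integral over an overlap be divided between two weights. *)
Lemma Lintegral_convex f x y : H_class w x y f -> x <= y ->
  convex_elements X (Lintegral P `[x, y] f).
Proof.
move=> fH xy s t s0 t0.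
have yx0 : 0 <= y - x by rewrite subr_ge0.
pose e n := w ((y - x) / n.+1%:R) * (y - x).
have ec (k : R) : (fun n => k * e n) @ \oo --> 0.
  rewrite -[X in _ --> X](mulr0 k); apply: cvgMr.
  by rewrite -(mul0r (y - x)); apply: cvgMl; exact: grid_cvg0.
apply: (mdist_eq_cvg0 _ (ec (s + t + (s + t)))) => n.
set L := Lintegral _ _ _; set A := ((y - x) *: mean n.+1 f x y)%SL.
have LA : mdist L A <= e n by exact: mdist_Lintegral_mean.
have cA : ((s + t)%R *: A = s *: A + t *: A)%SL.
  rewrite /A sscale_mean// !sscale_big_sadd -big_split/=; apply: eq_bigr => i _.
  by apply: convex_sscale => //; exact: (convexifying_convex hP).
rewrite (le_trans (metric_triangle _ ((s + t)%R *: A)%SL _))// mulrDl lerD//.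
  by rewrite mdist_sscale_pos ?addr_ge0// ler_wpM2l// addr_ge0.
rewrite cA (le_trans (mdist_sadd _ _ _ _))// mulrDl !mdist_sscale_pos//.
by rewrite metric_sym lerD// ler_wpM2l.
Qed.

End Mean.

(** * Integrals of the modulus and their means *)

Section RealMean.
Context {R : realType}.
Variables (w : R -> R) (hw : modulus_of_continuity w).
Local Notation mu := (@lebesgue_measure R).
Local Notation I x y := (\int[mu]_(s in `[x, y]) w s).

Lemma modulus_integrable (x y : R) : 0 <= x ->
  mu.-integrable `[x, y] (EFin \o w).
Proof.
move=> x0; apply: continuous_compact_integrable; first exact: segment_compact.
apply: continuous_subspaceW (modulus_continuous hw) => t /=.
by rewrite !in_itv/= andbT => /andP[/(le_trans x0)].
Qed.

Lemma modulus_sub_le (s t : R) : 0 <= s -> s <= t -> w t - w s <= w (t - s).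
Proof.
move=> s0 st; rewrite lerBlDr -{1}(subrK s t).
by apply: (modulus_semiadditive hw); rewrite // subr_ge0.
Qed.

(** Monotonicity puts the integral between the two endpoint rectangles; semi-additivity bounds the
    gap between them. *)
Lemma modulus_integral_cell (x y : R) : 0 <= x -> x <= y ->
  `|I x y - (y - x) * w x| <= w (y - x) * (y - x).
Proof.
move=> x0 xy; have yx0 : 0 <= y - x by rewrite subr_ge0.
have muxy : fine (mu `[x, y]) = y - x.
  rewrite (_ : mu `[x, y] = (y - x)%:E)//.
  exact: completed_lebesgue_measure_itv.
have cst (k : R) : mu.-integrable `[x, y] (EFin \o cst k).
  by apply: continuous_compact_integrable; [exact: segment_compact|
    apply: continuous_subspaceT => t; exact: cvg_cst].
have lo : w x * (y - x) <= I x y.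
  rewrite -muxy -Rintegral_cst//; apply: le_Rintegral => //; [exact: cst|exact: modulus_integrable|].
  move=> t /=; rewrite in_itv/= => /andP[xt _].
  exact: (modulus_nondecreasing hw).
have hi : I x y <= w y * (y - x).
  rewrite -muxy -Rintegral_cst//; apply: le_Rintegral => //; [exact: modulus_integrable|exact: cst|].
  move=> t /=; rewrite in_itv/= => /andP[xt ty].
  by apply: (modulus_nondecreasing hw) => //; exact: le_trans xt.
rewrite mulrC ger0_norm ?subr_ge0// (le_trans (lerB hi (lexx _)))//.
by rewrite -mulrBl ler_wpM2r// modulus_sub_le.
Qed.

Lemma modulus_integral_split (x y z : R) : 0 <= x -> x <= z -> z <= y ->
  I x y = I x z + I z y.
Proof.
move=> x0 xz zy; have z0 := le_trans x0 xz.
rewrite -(@Rintegral_itv_obnd_cbnd _ z (BRight y)).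
  rewrite -(@Rintegral_itvB R w (BLeft x) (BRight y) z) ?bnd_simp//.
    by rewrite addrC subrK.
  exact: modulus_integrable.
apply: integrableS (modulus_integrable y z0) => //.
by apply: subset_itvr; rewrite bnd_simp.
Qed.

Lemma modulus_integral_point (x : R) : I x x = 0.
Proof. by rewrite set_itv1 Rintegral_set1. Qed.

Lemma modulus_integral_partition (t : nat -> R) n : 0 <= t 0%N ->
    (forall i, (i < n)%N -> t i <= t i.+1) ->
  I (t 0%N) (t n) = \sum_(i < n) I (t i) (t i.+1).
Proof.
move=> t0; elim: n => [|n IHn] tle.
  by rewrite big_ord0 modulus_integral_point.
have tmono := partition_homo tle.
rewrite big_ord_recr/= -IHn => [|i ni]; last by apply: tle; exact: ltnW.
by apply: modulus_integral_split => //; exact: tmono.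
Qed.

Definition rmean n (k : R -> R) (x y : R) : R :=
  \sum_(i < n) n%:R^-1 * k (grid x y n i).

Lemma modulus_integral_mean n (x y : R) : 0 <= x -> x <= y ->
  `|I x y - (y - x) * rmean n.+1 w x y| <= w ((y - x) / n.+1%:R) * (y - x).
Proof.
move=> x0 xy.
have := @modulus_integral_partition (grid x y n.+1) n.+1.
rewrite grid0 gridn => /(_ x0 (fun i _ => grid_le _ i xy)) ->.
rewrite mulr_sumr -sumrB (le_trans (ler_norm_sum _ _ _))//.
have -> : w ((y - x) / n.+1%:R) * (y - x) =
    \sum_(i < n.+1) w ((y - x) / n.+1%:R) * ((y - x) / n.+1%:R).
  by rewrite sumr_const card_ord -mulrnAr -[(_ / _) *+ _]mulr_natr divfK ?pnatr_eq0.
apply: ler_sum => i _; rewrite [X in `|_ - X|]mulrA -(gridS x y n.+1 i).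
apply: modulus_integral_cell; last exact: grid_le.
by rewrite (le_trans x0)// -[leLHS](grid0 x y n.+1) grid_homo.
Qed.

End RealMean.

(** * Transport pieces: upper estimate by cost and its attainment *)

Section Transport.
Context {R : realType} {X : LSpaceType R}.
Variables (P : X -> X) (hP : convexifying P).
Variables (w : R -> R) (hw : modulus_of_continuity w).
Variables (A B : R).
Implicit Types (f g : R -> X).
Local Notation mu := (@lebesgue_measure R).
Local Notation I x y := (\int[mu]_(s in `[x, y]) w s).

(** Swapping the endpoints changes no sign; their order only records the direction in which the
    nodes of the matching [mean] run. *)
Definition oriented_integral f (x y : R) : X :=
  Lintegral P `[Num.min x y, Num.max x y] f.

Lemma mdist_oriented_integral_mean f x y n : H_class w A B f ->
    x \in `[A, B] -> y \in `[A, B] ->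
  mdist (oriented_integral f x y) (`|y - x| *: mean P n.+1 f x y)%SL <=
  w (`|y - x| / n.+1%:R) * `|y - x|.
Proof.
move=> fH; rewrite !in_itv/= => /andP[Ax xB] /andP[Ay yB].
rewrite /oriented_integral; have [xy|/ltW yx] := leP x y.
  rewrite ger0_norm ?subr_ge0//; apply: mdist_Lintegral_mean => //.
  exact: H_class_subitv fH Ax yB.
rewrite distrC ger0_norm ?subr_ge0//; apply: mdist_Lintegral_mean_rev => //.
exact: H_class_subitv fH Ay xB.
Qed.

(* The segment from src0 to src1 (in either direction), carrying mass of density
   rho, is mapped affinely onto the one from tgt0 to tgt1, where the density
   becomes sigma; the distance travelled runs from dst0 to dst1 and, as a
   variable, has density kappa. *)
Record piece := Piece {
  src0 : R ; src1 : R ; tgt0 : R ; tgt1 : R ; dst0 : R ; dst1 : R ;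
  rho : R ; sigma : R ; kappa : R }.

(** In [piece_dist] the whole piece moves to the right or the whole piece to the left, so the
    distance travelled stays affine along it. *)
Record piece_valid (p : piece) : Prop := PieceValid {
  piece_src0 : src0 p \in `[A, B] ; piece_src1 : src1 p \in `[A, B] ;
  piece_tgt0 : tgt0 p \in `[A, B] ; piece_tgt1 : tgt1 p \in `[A, B] ;
  piece_dst0 : 0 <= dst0 p ; piece_dst1 : dst0 p <= dst1 p ;
  piece_dist : (tgt0 p - src0 p = dst0 p /\ tgt1 p - src1 p = dst1 p) \/
               (src0 p - tgt0 p = dst0 p /\ src1 p - tgt1 p = dst1 p) ;
  piece_rho : 0 <= rho p ; piece_sigma : 0 <= sigma p ;
  piece_source_mass : rho p * `|src1 p - src0 p| = kappa p * (dst1 p - dst0 p) ;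
  piece_target_mass : sigma p * `|tgt1 p - tgt0 p| = kappa p * (dst1 p - dst0 p) }.

Definition source f p := (rho p *: oriented_integral f (src0 p) (src1 p))%SL.
Definition target f p := (sigma p *: oriented_integral f (tgt0 p) (tgt1 p))%SL.
Definition mass p := kappa p * (dst1 p - dst0 p).
Definition cost p := kappa p * I (dst0 p) (dst1 p).

Definition piece_error p n : R :=
  rho p * (w (`|src1 p - src0 p| / n.+1%:R) * `|src1 p - src0 p|) +
  sigma p * (w (`|tgt1 p - tgt0 p| / n.+1%:R) * `|tgt1 p - tgt0 p|) +
  `|kappa p| * (w ((dst1 p - dst0 p) / n.+1%:R) * (dst1 p - dst0 p)).

Section OnePiece.
Variables (p : piece) (hp : piece_valid p).

Lemma mass_ge0 : 0 <= mass p.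
Proof. by rewrite /mass -(piece_source_mass hp) mulr_ge0 ?(piece_rho hp). Qed.

Lemma piece_error_cvg0 : piece_error p @ \oo --> 0.
Proof.
have ec (k l : R) : 0 <= l -> (fun n => k * (w (l / n.+1%:R) * l)) @ \oo --> 0.
  move=> l0; rewrite -[X in _ --> X](mulr0 k); apply: cvgMr.
  by rewrite -(mul0r l); apply: cvgMl; exact: grid_cvg0.
rewrite -[X in _ --> X]addr0; apply: cvgD; last first.
  by apply: ec; rewrite subr_ge0 (piece_dst1 hp).
by rewrite -[X in _ --> X]addr0; apply: cvgD; exact: ec.
Qed.

Lemma mdist_source_mean f n : H_class w A B f ->
  mdist (source f p) (mass p *: mean P n.+1 f (src0 p) (src1 p))%SL <=
  rho p * (w (`|src1 p - src0 p| / n.+1%:R) * `|src1 p - src0 p|).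
Proof.
move=> fH; rewrite /source /mass -(piece_source_mass hp) -sscaleA.
rewrite mdist_sscale_pos ?(piece_rho hp)// ler_wpM2l ?(piece_rho hp)//.
exact: (mdist_oriented_integral_mean _ fH (piece_src0 hp) (piece_src1 hp)).
Qed.

Lemma mdist_target_mean f n : H_class w A B f ->
  mdist (target f p) (mass p *: mean P n.+1 f (tgt0 p) (tgt1 p))%SL <=
  sigma p * (w (`|tgt1 p - tgt0 p| / n.+1%:R) * `|tgt1 p - tgt0 p|).
Proof.
move=> fH; rewrite /target /mass -(piece_target_mass hp) -sscaleA.
rewrite mdist_sscale_pos ?(piece_sigma hp)// ler_wpM2l ?(piece_sigma hp)//.
exact: (mdist_oriented_integral_mean _ fH (piece_tgt0 hp) (piece_tgt1 hp)).
Qed.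

Lemma cost_mean n :
  `|cost p - mass p * rmean n.+1 w (dst0 p) (dst1 p)| <=
  `|kappa p| * (w ((dst1 p - dst0 p) / n.+1%:R) * (dst1 p - dst0 p)).
Proof.
rewrite /cost /mass -mulrA -mulrBr normrM ler_wpM2l//.
exact: (modulus_integral_mean hw n (piece_dst0 hp) (piece_dst1 hp)).
Qed.

Lemma affine_in (x y t : R) : x \in `[A, B] -> y \in `[A, B] ->
  0 <= t -> t <= 1 -> x + t * (y - x) \in `[A, B].
Proof.
rewrite !in_itv/= => /andP[Ax xB] /andP[Ay yB] t0 t1.
by apply/andP; split; nra.
Qed.

Lemma grid_param n i : (i < n.+1)%N -> (0 <= i%:R / n.+1%:R :> R) /\
  (i%:R / n.+1%:R <= 1 :> R).
Proof.
move=> ni; split; first by rewrite divr_ge0.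
by rewrite ler_pdivrMr// mul1r ler_nat ltnW.
Qed.

Lemma piece_dist_affine (t : R) : 0 <= t -> t <= 1 ->
  `|src0 p + t * (src1 p - src0 p) - (tgt0 p + t * (tgt1 p - tgt0 p))| =
  dst0 p + t * (dst1 p - dst0 p).
Proof.
move=> t0 t1; have st0 : 0 <= dst0 p + t * (dst1 p - dst0 p).
  by rewrite addr_ge0 ?mulr_ge0 ?subr_ge0 ?(piece_dst0 hp)// (piece_dst1 hp).
case: (piece_dist hp) => -[e0 e1].
  by rewrite distrC -[RHS]ger0_norm// -e0 -e1; congr `|_|; ring.
by rewrite -[RHS]ger0_norm// -e0 -e1; congr `|_|; ring.
Qed.

(** Node [i] of the source meets node [i] of the target with the same weight, and their distance is
    node [i] of the grid of distances. *)
Lemma mdist_mean_le f n : H_class w A B f ->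
  mdist (mean P n.+1 f (src0 p) (src1 p)) (mean P n.+1 f (tgt0 p) (tgt1 p)) <=
  rmean n.+1 w (dst0 p) (dst1 p).
Proof.
move=> fH; rewrite (le_trans (mdist_big_sadd _ _ _))//; apply: ler_sum => i _.
rewrite mdist_sscale_pos ?invr_ge0// ler_wpM2l ?invr_ge0//.
rewrite (le_trans (convexifying_mdist hP _ _))//.
have [t0 t1] := grid_param (ltn_ord i).
rewrite /grid -piece_dist_affine//; apply: fH.
  exact: (affine_in (piece_src0 hp) (piece_src1 hp)).
exact: (affine_in (piece_tgt0 hp) (piece_tgt1 hp)).
Qed.

Lemma mdist_piece_le f : H_class w A B f ->
  mdist (source f p) (target f p) <= cost p.
Proof.
move=> fH; rewrite -subr_le0.
apply: (ler_cvg_to (@cvg_cst _ _ _ _ _) piece_error_cvg0).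
apply: nearW => n; rewrite lerBlDr.
have m0 := mass_ge0.
have := mdist_source_mean n fH; have := mdist_target_mean n fH.
have := cost_mean n; rewrite distrC => /(le_trans (ler_norm _)).
have := ler_wpM2l m0 (mdist_mean_le n fH); rewrite -mdist_sscale_pos//.
rewrite /piece_error (metric_sym (target f p)).
have := metric_triangle (source f p)
  (mass p *: mean P n.+1 f (src0 p) (src1 p))%SL (target f p).
have := metric_triangle (mass p *: mean P n.+1 f (src0 p) (src1 p))%SL
  (mass p *: mean P n.+1 f (tgt0 p) (tgt1 p))%SL (target f p).
lra.
Qed.

End OnePiece.

Section Extremal.
Variables (hX : isotropic X) (e : X) (he : convex_elements X e).
Hypothesis e1 : mdist theta e = 1.

(** Convexity writes t e as (t - s) e + s e and isotropy cancels s e: the ray of [e] is an isometric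
    copy of the half-line. *)
Lemma mdist_sscale_isotropic (s t : R) : 0 <= s -> s <= t ->
  mdist (s *: e)%SL (t *: e)%SL = t - s.
Proof.
move=> s0 st; have ts0 : 0 <= t - s by rewrite subr_ge0.
rewrite -{1}(subrK s t) convex_sscaleDl// -{1}(sadd0r (s *: e)%SL) hX.
by rewrite -(sscale_theta (t - s)) mdist_sscale_pos// e1 mulr1.
Qed.

Variables (phi : R -> R).
Hypothesis phi_ge0 : forall t, t \in `[A, B] -> 0 <= phi t.
Hypothesis phi_lip : forall t1 t2, t1 \in `[A, B] -> t2 \in `[A, B] ->
  `|phi t1 - phi t2| <= w `|t1 - t2|.
Local Notation F := (fun t => (phi t *: e)%SL).

Lemma H_class_sscale : H_class w A B F.
Proof.
move=> t1 t2 t1AB t2AB; apply: le_trans (phi_lip t1AB t2AB).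
wlog le12 : t1 t2 t1AB t2AB / phi t1 <= phi t2.
  move=> wlg; have [|/ltW] := leP (phi t1) (phi t2); first exact: wlg.
  by rewrite metric_sym distrC; exact: wlg.
rewrite mdist_sscale_isotropic ?phi_ge0// distrC.
by rewrite ger0_norm// subr_ge0.
Qed.

Lemma mean_sscale n x y : x \in `[A, B] -> y \in `[A, B] ->
  mean P n.+1 F x y = (rmean n.+1 phi x y *: e)%SL /\
  0 <= rmean n.+1 phi x y.
Proof.
move=> xAB yAB; have phi0 (i : 'I_n.+1) : 0 <= n.+1%:R^-1 * phi (grid x y n.+1 i).
  have [t0 t1] := grid_param (ltn_ord i).
  by rewrite mulr_ge0 ?invr_ge0//; apply: phi_ge0; exact: affine_in.
split; last exact: sumr_ge0.
rewrite /rmean convex_sscale_suml//; apply: eq_bigr => i _.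
rewrite (convexifying_id hP) ?sscaleA//.
exact: convex_sscale.
Qed.

(** Complementary slackness between the potential and the transport plan. *)
Definition extremal_on p := forall t, 0 <= t -> t <= 1 ->
  phi (tgt0 p + t * (tgt1 p - tgt0 p)) - phi (src0 p + t * (src1 p - src0 p)) =
  w (dst0 p + t * (dst1 p - dst0 p)).

Lemma rmean_modulus_ge0 p n : piece_valid p ->
  0 <= rmean n.+1 w (dst0 p) (dst1 p).
Proof.
move=> hp; apply: sumr_ge0 => i _.
have [t0 t1] := grid_param (ltn_ord i).
rewrite mulr_ge0 ?invr_ge0//; apply: (modulus_ge0 hw).
rewrite addr_ge0 ?mulr_ge0 ?subr_ge0 ?(piece_dst0 hp)//; exact: (piece_dst1 hp).
Qed.

Lemma rmean_extremal p n : extremal_on p ->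
  rmean n.+1 phi (tgt0 p) (tgt1 p) =
  rmean n.+1 phi (src0 p) (src1 p) + rmean n.+1 w (dst0 p) (dst1 p).
Proof.
move=> pe; rewrite -big_split/=; apply: eq_bigr => i _; rewrite -mulrDr.
have [t0 t1] := grid_param (ltn_ord i).
by congr (_ * _); rewrite /grid -pe//; ring.
Qed.

(** Lower bounds for two distances do not add up, so both pieces are treated at once: isotropy
    removes [z], the Riemann sums become numbers on the ray of [e], and both increments from source
    to target are nonnegative there. *)
Lemma mdist_extremal_ge (z : X) (p q : piece) :
    piece_valid p -> piece_valid q -> extremal_on p -> extremal_on q ->
  cost p + cost q <= mdist (z + (source F p + source F q))%SL
                           (z + (target F p + target F q))%SL.
Proof.
move=> hp hq ep eq; set D := mdist _ _; have FH := H_class_sscale.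
rewrite -subr_le0.
have ec : (fun n => piece_error p n + piece_error q n) @ \oo --> 0.
  by rewrite -[X in _ --> X]addr0; apply: cvgD; exact: piece_error_cvg0.
apply: (ler_cvg_to (@cvg_cst _ _ _ _ _) ec).
apply: nearW => n; rewrite lerBlDr {}/D !(saddC z) !hX.
have [xp xp0] := mean_sscale n (piece_src0 hp) (piece_src1 hp).
have [yp yp0] := mean_sscale n (piece_tgt0 hp) (piece_tgt1 hp).
have [xq xq0] := mean_sscale n (piece_src0 hq) (piece_src1 hq).
have [yq yq0] := mean_sscale n (piece_tgt0 hq) (piece_tgt1 hq).
have := mdist_source_mean hp n FH; have := mdist_target_mean hp n FH.
have := mdist_source_mean hq n FH; have := mdist_target_mean hq n FH.
rewrite xp yp xq yq !sscaleA.
have := cost_mean hp n => /(le_trans (ler_norm _)).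
have := cost_mean hq n => /(le_trans (ler_norm _)).
have mp := mass_ge0 hp; have mq := mass_ge0 hq.
set ap := mass p * rmean _ w _ _; set aq := mass q * rmean _ w _ _.
set bp := mass p * rmean _ phi (src0 p) _; set bq := mass q * rmean _ phi (src0 q) _.
set cp := mass p * rmean _ phi (tgt0 p) _; set cq := mass q * rmean _ phi (tgt0 q) _.
have cpE : cp = bp + ap by rewrite /cp rmean_extremal// mulrDr.
have cqE : cq = bq + aq by rewrite /cq rmean_extremal// mulrDr.
have bp0 : 0 <= bp by rewrite mulr_ge0.
have bq0 : 0 <= bq by rewrite mulr_ge0.
have ap0 : 0 <= ap by rewrite mulr_ge0 ?rmean_modulus_ge0.
have aq0 : 0 <= aq by rewrite mulr_ge0 ?rmean_modulus_ge0.
have bc : mdist ((bp + bq)%R *: e)%SL ((cp + cq)%R *: e)%SL = ap + aq.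
  by rewrite mdist_sscale_isotropic ?cpE ?cqE; [ring|exact: addr_ge0|lra].
have := metric_triangle ((bp + bq)%R *: e)%SL (source F p + source F q)%SL
  ((cp + cq)%R *: e)%SL.
have := metric_triangle (source F p + source F q)%SL
  (target F p + target F q)%SL ((cp + cq)%R *: e)%SL.
rewrite bc !convex_sscaleDl ?cpE ?cqE ?addr_ge0//.
have := mdist_sadd (bp *: e)%SL (bq *: e)%SL (source F p) (source F q).
have := mdist_sadd (target F p) (target F q) ((bp + ap)%R *: e)%SL
  ((bq + aq)%R *: e)%SL.
rewrite (metric_sym (bp *: e)%SL) (metric_sym (bq *: e)%SL).
rewrite !convex_sscaleDl// /piece_error; lra.
Qed.

End Extremal.

End Transport.

(** * The dual potential of a concave modulus *)

Section Potential.
Context {R : realType}.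
Variables (w : R -> R) (hw : modulus_of_continuity w) (cw : concave_modulus w).

Lemma concave_modulus_le (x y s t : R) : 0 <= x -> 0 <= y -> 0 <= s -> 0 <= t ->
  s + t = 1 -> s * w x + t * w y <= w (s * x + t * y).
Proof.
move=> x0 y0 s0 t0 st1; have s1 : s <= 1 by rewrite -st1 lerDl.
have := cw (@Itv01 R s s0 s1).
move=> /(_ x y); rewrite !inE/= !in_itv/= !andbT => /(_ x0 y0) cxy.
have {cxy} : - w (s * x + (1 - s) * y) <= s * - w x + (1 - s) * - w y.
  exact: cxy.
rewrite (_ : 1 - s = t); last by rewrite -st1; ring.
by rewrite !mulrN -opprD lerN2.
Qed.

Lemma concave_modulus_chord (x y z : R) : 0 <= x -> x <= z -> z <= y ->
  (y - z) * w x + (z - x) * w y <= (y - x) * w z.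
Proof.
move=> x0 xz zy; have [xy|xy] := eqVneq x y.
  have -> : z = x by apply/eqP; rewrite eq_le xz xy zy.
  by rewrite xy !subrr !mul0r addr0.
have xy0 : 0 < y - x by rewrite subr_gt0 lt_neqAle xy (le_trans xz).
have xyN : y - x != 0 by rewrite gt_eqF.
have y0 : 0 <= y by rewrite (le_trans x0)// (le_trans xz).
have := @concave_modulus_le x y ((y - z) / (y - x)) ((z - x) / (y - x)) x0 y0.
rewrite !divr_ge0 ?subr_ge0 ?(ltW xy0)// ?(le_trans xz)// => /(_ isT isT).
rewrite (_ : _ / _ * x + _ = z); last by field.
rewrite (_ : _ / _ + _ = 1); last by field.
move=> /(_ erefl); rewrite mulrAC [X in _ + X]mulrAC -mulrDl ler_pdivrMr//.
by rewrite [w z * _]mulrC.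
Qed.

(** With [g] the identity, this is how far one end of a pair at distance [s] lies from the
    interface: speed [a] up to [L], then [b]. With [g] equal to [w], it is the potential at that
    end, up to sign. *)
Definition bent (a b L : R) (g : R -> R) (s : R) : R :=
  if s <= L then a * g s else a * g L + b * (g s - g L).

Lemma bentS a a' b b' L g s : a + a' = 1 -> b + b' = 1 ->
  bent a b L g s + bent a' b' L g s = g s.
Proof.
move=> aa bb; rewrite /bent; case: ifP => _.
  by rewrite -mulrDl aa mul1r.
by rewrite addrACA -!mulrDl aa bb !mul1r addrC subrK.
Qed.

Lemma bent_ge a b L g s : L <= s ->
  bent a b L g s = a * g L + b * (g s - g L).
Proof.
move=> Ls; rewrite /bent; case: ifPn => // sL.
have -> : s = L by apply/eqP; rewrite eq_le sL Ls.
by rewrite subrr mulr0 addr0.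
Qed.

Lemma bent_le a b L g s : s <= L -> bent a b L g s = a * g s.
Proof. by rewrite /bent => ->. Qed.

Lemma bent_id_ge0 a b L s : 0 <= a -> 0 <= b -> 0 <= L -> 0 <= s ->
  0 <= bent a b L id s.
Proof.
move=> a0 b0 L0 s0; rewrite /bent; have [sL|sL] := leP s L; first by rewrite mulr_ge0.
by rewrite addr_ge0 ?mulr_ge0// subr_ge0 ltW.
Qed.

Lemma bent_id_onto a b L u : 0 <= a -> 0 < b -> 0 <= L -> 0 <= u ->
  exists2 s, 0 <= s & bent a b L id s = u.
Proof.
move=> a0 b0 L0 u0; have [uL|uL] := leP u (a * L).
  (* For [a = 0] the first branch is flat and reaches only 0. *)
  have [a00|aN] := eqVneq a 0.
    exists 0 => //; rewrite bent_le// mulr0; apply/eqP.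
    by rewrite eq_le u0 (le_trans uL)// a00 mul0r.
  have a1 : 0 < a by rewrite lt_neqAle eq_sym aN.
  exists (u / a); first by rewrite divr_ge0.
  rewrite bent_le; first by rewrite mulrC divfK.
  by rewrite ler_pdivrMr// mulrC.
have Ls : L <= L + (u - a * L) / b.
  by rewrite lerDl divr_ge0 ?(ltW b0)// subr_ge0 ltW.
exists (L + (u - a * L) / b); first exact: le_trans Ls.
by rewrite bent_ge//; field; rewrite gt_eqF.
Qed.

Section Paired.
Variables (p q r r' L : R).
Hypotheses (pq : p + q = 1) (rr : r + r' = 1).
Hypotheses (p_ge0 : 0 <= p) (pr : p <= r) (r_gt0 : 0 < r) (r'_gt0 : 0 < r').
Hypothesis L_ge0 : 0 <= L.

Lemma q_gt0 : 0 < q. Proof. by move: pq rr pr r'_gt0; lra. Qed.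

(** Dual feasibility for ends that need not be partners: the source end belongs to distance [s], the
    target end to distance [t]. *)
Lemma bent_cross (s t : R) : 0 <= s -> 0 <= t ->
  bent p r L w s + bent q r' L w t <= w (bent p r L id s + bent q r' L id t).
Proof.
move=> s0 t0; have q0 := q_gt0.
have [sL|/ltW Ls] := leP s L; have [tL|/ltW Lt] := leP t L.
- rewrite !bent_le//; apply: concave_modulus_le => //; exact: ltW.
- rewrite !(bent_le _ _ _ sL) !(bent_ge _ _ _ Lt).
  have rN : r != 0 by rewrite gt_eqF.
  (* The masses are [p] at [s], [r - p] at [L] and [r'] at [t]. As [p <= r], concavity first merges
     the two former at [v] with mass [r], then merges [v] with [t]. *)
  have L1 : p / r * w s + (r - p) / r * w L <= w (p / r * s + (r - p) / r * L).
    apply: concave_modulus_le => //; rewrite ?divr_ge0 ?subr_ge0 ?(ltW r_gt0)//.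
    by field.
  set v := p / r * s + (r - p) / r * L in L1.
  have v0 : 0 <= v.
    by rewrite addr_ge0// mulr_ge0// divr_ge0 ?subr_ge0 ?(ltW r_gt0).
  have L2 := concave_modulus_le v0 t0 (ltW r_gt0) (ltW r'_gt0) rr.
  have -> : p * s + (q * L + r' * (t - L)) = r * v + r' * t.
    have -> : q = 1 - p by rewrite -pq; ring.
    by have -> : r' = 1 - r; [rewrite -rr; ring|rewrite /v; field].
  apply: le_trans L2; rewrite -subr_ge0.
  have -> : r * w v + r' * w t - (p * w s + (q * w L + r' * (w t - w L))) =
      r * (w v - (p / r * w s + (r - p) / r * w L)).
    have -> : q = 1 - p by rewrite -pq; ring.
    by have -> : r' = 1 - r; [rewrite -rr; ring|field].
  by rewrite mulr_ge0 ?(ltW r_gt0)// subr_ge0.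
- rewrite !(bent_ge _ _ _ Ls) !(bent_le _ _ _ tL).
  (* The masses q at t and r at s are a mean-preserving spread of the masses
     r - p at L and 1 at z, so the chord over [t, s] bounds both values. *)
  set z := p * L + r * (s - L) + q * t.
  have qE : q = 1 - p by rewrite -pq; ring.
  have [ts|tNs] := eqVneq t s.
    have Ls' : L = s by apply/eqP; rewrite eq_le Ls -ts tL.
    rewrite /z ts Ls' !subrr !mulr0 !addr0 -!mulrDl pq !mul1r.
    by rewrite le_refl.
  have ts0 : 0 < s - t by rewrite subr_gt0 lt_neqAle tNs (le_trans tL).
  have tz : t <= z.
    rewrite /z qE -subr_ge0 (_ : _ - _ = r * (s - L) + p * (L - t)); last by ring.
    by rewrite addr_ge0// mulr_ge0 ?subr_ge0 ?(ltW r_gt0).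
  have zs : z <= s.
    rewrite /z -subr_ge0 (_ : _ - _ = r' * (s - L) + q * (L - t)).
      by rewrite addr_ge0// mulr_ge0 ?subr_ge0 ?(ltW r'_gt0) ?(ltW q0).
    by rewrite qE; have -> : r' = 1 - r; [rewrite -rr; ring|ring].
  have c1 := concave_modulus_chord t0 tz zs.
  have c2 := concave_modulus_chord t0 tL Ls.
  have rp0 : 0 <= r - p by rewrite subr_ge0.
  rewrite -subr_ge0 -(pmulr_rge0 _ ts0).
  have -> : (s - t) * (w z - (p * w L + r * (w s - w L) + q * w t)) =
    ((s - t) * w z - ((s - z) * w t + (z - t) * w s)) +
    (r - p) * ((s - t) * w L - ((s - L) * w t + (L - t) * w s)).
    by rewrite /z qE; ring.
  by rewrite addr_ge0 ?mulr_ge0// subr_ge0.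
- rewrite !bent_ge//.
  have -> : p * w L + r * (w s - w L) + (q * w L + r' * (w t - w L)) =
      r * w s + r' * w t.
    have -> : q = 1 - p by rewrite -pq; ring.
    by have -> : r' = 1 - r; [rewrite -rr; ring|ring].
  have -> : p * L + r * (s - L) + (q * L + r' * (t - L)) = r * s + r' * t.
    have -> : q = 1 - p by rewrite -pq; ring.
    by have -> : r' = 1 - r; [rewrite -rr; ring|ring].
  by apply: concave_modulus_le => //; exact: ltW.
Qed.

End Paired.

End Potential.

(* The pair (g1, g2) solves the dual transport problem of cost w(u + v) between
   two half-lines glued at the origin: each g is the w-conjugate of the other,
   which makes it nondecreasing and w-Lipschitz. *)
Section Conjugate.
Context {R : realType}.
Variables (w : R -> R) (hw : modulus_of_continuity w).
Variables (g1 g2 : R -> R).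
Hypothesis cross : forall u v, 0 <= u -> 0 <= v -> g1 u + g2 v <= w (u + v).

Lemma conjugate_lipschitz :
    (forall u, 0 <= u -> exists2 v, 0 <= v & g1 u + g2 v = w (u + v)) ->
  forall u1 u2, 0 <= u1 -> u1 <= u2 -> 0 <= g1 u2 - g1 u1 <= w (u2 - u1).
Proof.
move=> paired u1 u2 u10 u12; have u20 := le_trans u10 u12.
have [v1 v10 e1] := paired _ u10; have [v2 v20 e2] := paired _ u20.
(* Exchange partners: [u2] with the partner of [u1] yields the upper bound by semi-additivity, [u1]
   with the partner of [u2] yields monotonicity. *)
have c12 := cross u20 v10; have c21 := cross u10 v20.
have wm := modulus_nondecreasing hw (addr_ge0 u10 v20) (lerD u12 (lexx v2)).
have ws := modulus_sub_le hw (addr_ge0 u10 v10) (lerD u12 (lexx v1)).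
rewrite opprD addrACA subrr addr0 in ws.
by apply/andP; split; lra.
Qed.

End Conjugate.

Section ExtremalPotential.
Context {R : realType}.
Variables (w : R -> R) (hw : modulus_of_continuity w) (cw : concave_modulus w).
Variables (p q r r' L : R).
Hypotheses (pq : p + q = 1) (rr : r + r' = 1).
Hypotheses (p_ge0 : 0 <= p) (pr : p <= r) (r_gt0 : 0 < r) (r'_gt0 : 0 < r').
Hypothesis L_ge0 : 0 <= L.
Local Notation U := (bent p r L id).
Local Notation V := (bent q r' L id).

(** The interface is put at 0, sources to its left and targets to its right; the pair at distance
    [s] consists of [- U s] and [V s]. *)
Lemma extremal_potential : exists phi : R -> R,
  (forall t1 t2, t1 <= t2 -> 0 <= phi t2 - phi t1 <= w (t2 - t1)) /\
  (forall s, 0 <= s -> phi (V s) - phi (- U s) = w s).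
Proof.
have q0 := q_gt0 pq rr pr r'_gt0.
have U0 s : 0 <= s -> 0 <= U s by apply: bent_id_ge0 => //; exact: ltW.
have V0 s : 0 <= s -> 0 <= V s by apply: bent_id_ge0 => //; exact: ltW.
have UV s : U s + V s = s by exact: bentS.
have G s : bent p r L w s + bent q r' L w s = w s by exact: bentS.
have C := bent_cross cw pq rr p_ge0 pr r_gt0 r'_gt0 L_ge0.
(* A preimage is chosen because [U] is not injective when [p = 0] and [L > 0]. *)
have /choice[S1 hS1] u : exists s, 0 <= u -> 0 <= s /\ U s = u.
  have [u0|u0] := leP 0 u; last by exists 0.
  by have [s s0 <-] := bent_id_onto p_ge0 r_gt0 L_ge0 u0; exists s.
have /choice[S2 hS2] v : exists s, 0 <= v -> 0 <= s /\ V s = v.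
  have [v0|v0] := leP 0 v; last by exists 0.
  by have [s s0 <-] := bent_id_onto (ltW q0) r'_gt0 L_ge0 v0; exists s.
pose g1 u := bent p r L w (S1 u); pose g2 v := bent q r' L w (S2 v).
(* The choice of preimage is immaterial: if [U t = U s], then pairing each of the two with the
   partner of the other gives inequalities in both directions. *)
have g1E s : 0 <= s -> g1 (U s) = bent p r L w s.
  move=> s0; have [] := hS1 _ (U0 _ s0); rewrite /g1; set t := S1 _ => t0 tU.
  have := C _ _ t0 s0; rewrite tU UV => le1.
  have := C _ _ s0 t0; rewrite -tU UV => le2.
  have := G s; have := G t; lra.
have g2E s : 0 <= s -> g2 (V s) = bent q r' L w s.
  move=> s0; have [] := hS2 _ (V0 _ s0); rewrite /g2; set t := S2 _ => t0 tV.
  have := C _ _ s0 t0; rewrite tV UV => le1.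
  have := C _ _ t0 s0; rewrite -tV UV => le2.
  have := G s; have := G t; lra.
have cross u v : 0 <= u -> 0 <= v -> g1 u + g2 v <= w (u + v).
  move=> u0 v0; have [s0 su] := hS1 _ u0; have [t0 tv] := hS2 _ v0.
  by have := C _ _ s0 t0; rewrite su tv.
have g1L := conjugate_lipschitz hw cross.
have {}g1L : forall u1 u2, 0 <= u1 -> u1 <= u2 -> 0 <= g1 u2 - g1 u1 <= w (u2 - u1).
  apply: g1L => u u0; have [] := hS1 _ u0; rewrite /g1; set s := S1 u => s0 <-.
  by exists (V s); [exact: V0|rewrite g2E// UV; exact: G].
have g2L : forall u1 u2, 0 <= u1 -> u1 <= u2 -> 0 <= g2 u2 - g2 u1 <= w (u2 - u1).
  apply: (@conjugate_lipschitz R w hw g2 g1) => [u v u0 v0|v v0].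
    by rewrite addrC (addrC u); exact: cross.
  have [] := hS2 _ v0; rewrite /g2; set s := S2 v => s0 <-.
  by exists (U s); [exact: U0|rewrite g1E// addrC (addrC (V s)) UV; exact: G].
have V00 : V 0 = 0 by rewrite bent_le// mulr0.
have U00 : U 0 = 0 by rewrite bent_le// mulr0.
have g0 : g1 0 + g2 0 = 0.
  have := g1E _ (lexx 0); have := g2E _ (lexx 0); rewrite V00 U00 => -> ->.
  by rewrite G (modulus0 hw).
(* By [g0] the two branches agree at 0. For points on opposite sides of 0 the Lipschitz bound is
   [cross] itself. *)
pose phi t := if t <= 0 then - g1 (- t) else g2 t.
have phi_ge t : 0 <= t -> phi t = g2 t.
  move=> t0; rewrite /phi; case: ifPn => // tle0.
  have -> : t = 0 by apply/eqP; rewrite eq_le t0 tle0.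
  by rewrite oppr0; move: g0; lra.
have phi_le t : t <= 0 -> phi t = - g1 (- t) by rewrite /phi => ->.
exists phi; split=> [t1 t2 t12|s s0]; last first.
  rewrite phi_ge ?V0// phi_le ?oppr_le0 ?U0// !opprK g1E// g2E//.
  by rewrite addrC G.
have [t20|/ltW t20] := leP t2 0.
  have t10 := le_trans t12 t20; rewrite !phi_le//.
  have := g1L (- t2) (- t1); rewrite oppr_ge0 lerN2 => /(_ t20 t12).
  by rewrite !opprK addrC [X in w X]addrC.
have [t10|/ltW t10] := leP t1 0; last first.
  by rewrite !phi_ge//; exact: g2L.
rewrite phi_ge// phi_le// opprK.
have t1N : 0 <= - t1 by rewrite oppr_ge0.
have := g1L _ _ (lexx 0) t1N; have := g2L _ _ (lexx 0) t20.
have := cross _ _ t1N t20; rewrite (addrC (- t1)) => c.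
by move=> /andP[g2p _] /andP[g1p _]; apply/andP; split; lra.
Qed.

End ExtremalPotential.

(** * From a transport plan and a potential to a sharp bound *)

Section Sharp.
Context {R : realType} {X : LSpaceType R}.
Variables (P : X -> X) (hP : convexifying P).
Hypothesis hX : invertible_elements X `&` convex_elements X <> [set theta].
Variables (w : R -> R) (hw : modulus_of_continuity w).
Implicit Types (A B : R) (f : R -> X) (p q : @piece R).

Lemma unit_convex_element :
  exists2 e : X, convex_elements X e & mdist theta e = 1.
Proof.
have th : (invertible_elements X `&` convex_elements X) theta.
  split; first by exists theta; rewrite saddr0.
  by move=> s t _ _; rewrite !sscale_theta saddr0.
have [e [_ ce] eN] : exists2 e : X,
    (invertible_elements X `&` convex_elements X) e & e <> theta.
  apply: contrapT => nex; apply: hX; rewrite eqEsubset; split=> [e he|_ ->//].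
  by apply: contrapT => eN; apply: nex; exists e.
have e0 : 0 < mdist theta e by rewrite mdist_gt0 eq_sym; apply/eqP.
exists ((mdist theta e)^-1 *: e)%SL; first exact: convex_sscale.
rewrite -{1}(sscale_theta (mdist theta e)^-1) mdist_sscale_pos.
  by rewrite mulVf// gt_eqF.
by rewrite invr_ge0 ltW.
Qed.

(** [z] is the mass that stays in place; it may depend on [f]. Two pieces are enough for every
    position of the segments. *)
Lemma transport_sharp A B p q (D : (R -> X) -> R) : A <= B ->
    piece_valid A B p -> piece_valid A B q ->
    (forall f, H_class w A B f -> exists z : X, D f =
      mdist (z + (source P f p + source P f q))%SL
            (z + (target P f p + target P f q))%SL) ->
    (concave_modulus w -> exists phi : R -> R,
      [/\ forall t1 t2, t1 \in `[A, B] -> t2 \in `[A, B] ->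
            `|phi t1 - phi t2| <= w `|t1 - t2|,
          extremal_on w phi p & extremal_on w phi q]) ->
  (forall f, H_class w A B f -> D f <= cost w p + cost w q) /\
  (isotropic X -> concave_modulus w ->
    ereal_sup [set (D f)%:E | f in H_class w A B] = (cost w p + cost w q)%:E).
Proof.
move=> AB hp hq hD hphi.
have ub f : H_class w A B f -> D f <= cost w p + cost w q.
  move=> fH; have [z ->] := hD f fH.
  rewrite (le_trans (mdist_sadd _ _ _ _))// mdistxx add0r.
  rewrite (le_trans (mdist_sadd _ _ _ _))//.
  by rewrite lerD//; exact: mdist_piece_le fH.
split=> // iX cw; have [e ce e1] := unit_convex_element.
have [phi0 [lip0 ep0 eq0]] := hphi cw.
have AAB : A \in `[A, B] by rewrite in_itv/= lexx.
(* Convexity of e controls only nonnegative multiples: (-1) e need not be the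
   inverse of e.  Hence the shift. *)
pose phi t := phi0 t - phi0 A + w (B - A).
have phi_ge0 t : t \in `[A, B] -> 0 <= phi t.
  move=> tAB; have := lip0 _ _ AAB tAB; have := ler_norm (phi0 A - phi0 t).
  have wle : w `|A - t| <= w (B - A).
    apply: modulus_norm_le => //; move: tAB; rewrite in_itv/= => /andP[At tB].
    exact: norm_cell_le.
  by rewrite /phi; lra.
have lip t1 t2 : t1 \in `[A, B] -> t2 \in `[A, B] ->
    `|phi t1 - phi t2| <= w `|t1 - t2|.
  move=> t1AB t2AB; apply: le_trans (lip0 _ _ t1AB t2AB).
  by rewrite le_eqVlt; apply/orP; left; apply/eqP; congr `|_|; rewrite /phi; ring.
have shift r : extremal_on w phi0 r -> extremal_on w phi r.
  by move=> er t t0 t1; rewrite -er// /phi; ring.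
have FH := H_class_sscale iX ce e1 phi_ge0 lip.
apply/eqP; rewrite eq_le; apply/andP; split.
  by apply: ge_ereal_sup => _ [f fH <-]; rewrite lee_fin; exact: ub.
(* The supremum is attained, at [phi] times [e]. *)
apply: ereal_sup_ge; eexists; first by exists (fun t => phi t *: e)%SL.
rewrite lee_fin; have [z ->] := hD _ FH.
apply: (mdist_extremal_ge hP hw iX ce e1 phi_ge0 lip z hp hq); exact: shift.
Qed.

Lemma monotone_lipschitz (phi : R -> R) :
    (forall t1 t2, t1 <= t2 -> 0 <= phi t2 - phi t1 <= w (t2 - t1)) ->
  forall t1 t2, `|phi t1 - phi t2| <= w `|t1 - t2|.
Proof.
move=> h t1 t2; have [t12|/ltW t21] := leP t1 t2.
  have /andP[h0 hw'] := h _ _ t12.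
  by rewrite distrC (distrC t1) !ger0_norm// subr_ge0.
by have /andP[h0 hw'] := h _ _ t21; rewrite !ger0_norm// subr_ge0.
Qed.

(** An empty move, filling the slots of [transport_sharp] when fewer than two moves occur. *)
Definition trivial_piece (x : R) : piece := Piece x x x x 0 0 0 0 0.

Lemma trivial_piece_valid A B x : x \in `[A, B] ->
  piece_valid A B (trivial_piece x).
Proof.
move=> xAB; split => //=; rewrite ?subrr ?normr0 ?mulr0 ?mul0r//.
by left.
Qed.

Lemma trivial_piece_extremal phi x : extremal_on w phi (trivial_piece x).
Proof. by move=> t _ _ /=; rewrite !subrr !mulr0 add0r (modulus0 hw). Qed.

Lemma trivial_piece_source f x : source P f (trivial_piece x) = theta.
Proof. exact: sscale0. Qed.

Lemma trivial_piece_target f x : target P f (trivial_piece x) = theta.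
Proof. exact: sscale0. Qed.

Lemma trivial_piece_cost x : cost w (trivial_piece x) = 0.
Proof. exact: mul0r. Qed.

Lemma oriented_integral_le f (x y : R) : x <= y ->
  oriented_integral P f x y = Lintegral P `[x, y] f.
Proof. by move=> xy; rewrite /oriented_integral min_l// max_r. Qed.

Lemma oriented_integral_ge f (x y : R) : y <= x ->
  oriented_integral P f x y = Lintegral P `[y, x] f.
Proof. by move=> xy; rewrite /oriented_integral min_r// max_l. Qed.

End Sharp.

(** * The possible positions of the two segments *)

Section Cases.
Context {R : realType} {X : LSpaceType R}.
Variables (P : X -> X) (hP : convexifying P).
Hypothesis hX : invertible_elements X `&` convex_elements X <> [set theta].
Variables (w : R -> R) (hw : modulus_of_continuity w).
Variables (a b c d : R).
Hypotheses (hab : a < b) (hcd : c < d) (hac : a <= c).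
Local Notation mu := (@lebesgue_measure R).
Local Notation I x y := (\int[mu]_(s in `[x, y]) w s)%R.
Local Notation deviation := (fun f : R -> X =>
  mdist ((b - a)^-1 *: Lintegral P `[a, b] f)%SL
        ((d - c)^-1 *: Lintegral P `[c, d] f)%SL).

Definition sharp (B bound : R) : Prop :=
  (forall f : R -> X, H_class w a B f -> deviation f <= bound) /\
  (isotropic X -> concave_modulus w ->
    ereal_sup [set (deviation f)%:E | f in H_class w a B] = bound%:E).

Lemma sharp_disjoint : b <= c ->
  sharp d (1 / (b - a + (d - c)) * I (c - b) (d - a)).
Proof.
move=> bc; have l0 : 0 < b - a by rewrite subr_gt0.
have k0 : 0 < d - c by rewrite subr_gt0.
have lk0 : 0 < b - a + (d - c) by rewrite addr_gt0.
have [lN kN lkN] : [/\ b - a != 0, d - c != 0 & b - a + (d - c) != 0].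
  by rewrite !gt_eqF.
pose p := trivial_piece b.
(* Everything moves: [b] goes to [c] and [a] to [d]. The distances fill an interval of length (d -
   a) - (c - b) = (b - a) + (d - c), over which the total mass 1 is spread evenly. *)
pose q := Piece b a c d (c - b) (d - a) (b - a)^-1 (d - c)^-1
  (1 / (b - a + (d - c))).
have -> : 1 / (b - a + (d - c)) * I (c - b) (d - a) = cost w p + cost w q.
  by rewrite trivial_piece_cost add0r.
apply: (transport_sharp hP hX hw).
- lra.
- by apply: trivial_piece_valid; rewrite in_itv/=; lra.
- split => /=; rewrite ?in_itv/= ?invr_ge0; try lra.
  + by rewrite distrC gtr0_norm//; field; rewrite lkN lN.
  + by rewrite gtr0_norm//; field; rewrite lkN kN.
- move=> f fH; exists theta.
  rewrite trivial_piece_source trivial_piece_target !sadd0r /source /target /=.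
  by rewrite oriented_integral_ge ?oriented_integral_le// ltW.
(* The interface is [b]. Up to distance [c - b] the source end rests at [b] while the target end
   crosses the gap, whence the speeds 0 and 1; the piece [q] uses only larger distances. *)
- move=> cw; have [|||||||phi [phim phie]] := @extremal_potential R w hw cw
    0 1 ((b - a) / (b - a + (d - c))) ((d - c) / (b - a + (d - c))) (c - b).
  + by rewrite add0r.
  + by field.
  + by [].
  + by rewrite divr_ge0// ltW.
  + by rewrite divr_gt0.
  + by rewrite divr_gt0.
  + by rewrite subr_ge0.
  exists (fun t => phi (t - b)); split.
  + move=> t1 t2 _ _; have := monotone_lipschitz phim (t1 - b) (t2 - b).
    by rewrite opprB addrA subrK.
  + exact: trivial_piece_extremal.
  + move=> t t0 t1 /=.
    have st : c - b <= c - b + t * (d - a - (c - b)).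
      by rewrite lerDl mulr_ge0//; lra.
    rewrite -phie; last by rewrite (le_trans _ st)// subr_ge0.
    by rewrite !bent_ge//=; congr (phi _ - phi _); field.
Qed.

Lemma sharp_overlap_left (M m : R) : M = b - a -> m = d - c -> m <= M ->
    c <= b -> b <= d ->
  sharp d (1 / (M + m) * I (M * (b - c) / m) (d - a) +
           (M - m) / M ^+ 2 * I 0 (M * (b - c) / m)).
Proof.
move: (hab) (hcd) (hac) => ab cd ac EM Em mM cb bd; have M0 : 0 < M by rewrite EM subr_gt0.
have m0 : 0 < m by rewrite Em subr_gt0.
have Mm0 : 0 < M + m by rewrite addr_gt0.
have [MN mN MmN] : [/\ M != 0, m != 0 & M + m != 0] by rewrite !gt_eqF.
have [L LD] : exists L, L = M * (b - c) / m by eexists.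
rewrite -LD.
have mL : m * L = M * (b - c) by rewrite LD; field.
have L0 : 0 <= L by rewrite LD divr_ge0 ?mulr_ge0 ?(ltW M0) ?(ltW m0)// subr_ge0.
have [M_ge0 m_ge0] : 0 <= M /\ 0 <= m by split; exact: ltW.
have bcL : b - c <= L.
  by rewrite LD ler_pdivlMr// mulrC ler_wpM2r// subr_ge0.
(* The excess of density 1/M on [c', c] exactly fills the deficit of density 1/m - 1/M on [c, b].
   The point [c'] is sent to [b], so [L] is the distance at which the two pieces meet. *)
have [c' cD] : exists c', c' = b - L by eexists.
have Lad : L <= d - a.
  rewrite LD ler_pdivrMr// -subr_ge0 EM Em.
  have -> : (d - a) * (d - c) - (b - a) * (b - c) =
    (d - b) * (d - a + (b - c)) by ring.
  have ad : a <= d by rewrite (le_trans hac)// ltW.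
  by rewrite mulr_ge0 ?subr_ge0// addr_ge0 ?subr_ge0.
have dbE : d - b = m / (M + m) * (d - a - L).
  apply: (mulfI MmN); have -> : (M + m) * (d - b) = m * (d - a) - m * L.
    by rewrite mL EM Em; ring.
  by field.
have caE : c' - a = M / (M + m) * (d - a - L).
  apply: (mulfI MmN).
  have -> : (M + m) * (c' - a) = M * (b - a) + m * (b - a) - M * L - m * L.
    by rewrite cD; ring.
  rewrite mL (_ : _ * (_ / _ * _) = M * (d - a) - M * L); last by field.
  by rewrite EM Em; ring.
have ac' : a <= c'.
  by rewrite -subr_ge0 caE mulr_ge0 ?divr_ge0 ?subr_ge0// ltW.
have c'c : c' <= c by rewrite cD; lra.
have LE : L - (b - c) = (M - m) / M * L by rewrite LD; field; rewrite MN mN.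
have bcE : b - c = m / M * L by rewrite LD; field; rewrite MN mN.
have mMV : 0 <= m^-1 - M^-1 by rewrite subr_ge0 lef_pV2.
pose p := Piece c c' c b 0 L M^-1 (m^-1 - M^-1) ((M - m) / M ^+ 2).
pose q := Piece c' a b d L (d - a) M^-1 m^-1 (1 / (M + m)).
rewrite addrC -/(cost w p) -/(cost w q).
apply: (transport_sharp hP hX hw).
- lra.
- split => /=; rewrite ?in_itv/= ?invr_ge0//; try lra.
  + rewrite distrC ger0_norm ?subr_ge0// (_ : c - c' = L - (b - c)).
      by rewrite LE; field.
    by rewrite cD; ring.
  + by rewrite ger0_norm ?subr_ge0// bcE; field; rewrite MN mN.
- split => /=; rewrite ?in_itv/= ?invr_ge0//; try lra.
  + by rewrite distrC ger0_norm ?subr_ge0// caE; field; rewrite MmN MN.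
  + by rewrite ger0_norm ?subr_ge0// dbE; field; rewrite MmN mN.
- move=> f fH; rewrite -EM -Em; exists (M^-1 *: Lintegral P `[c, b] f)%SL.
  have fab : H_class w a b f by exact: H_class_subitv fH _ bd.
  have fcd : H_class w c d f by exact: H_class_subitv fH hac _.
  have fac : H_class w a c f by exact: H_class_subitv fab _ cb.
  have fcb : H_class w c b f by exact: H_class_subitv fcd _ bd.
  congr (mdist _ _).
    rewrite /source /= !oriented_integral_ge//.
    rewrite (Lintegral_split hP hw fab hac cb) (Lintegral_split hP hw fac ac' c'c).
    rewrite !sscaleDr saddC; congr sadd; exact: saddC.
  rewrite /target /= !oriented_integral_le//.
  rewrite (Lintegral_split hP hw fcd cb bd) sscaleDr saddA; congr sadd.
  rewrite -convex_sscaleDl ?invr_ge0//; last exact: Lintegral_convex fcb _.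
  by congr sscale; ring.
(* The interface is [c], and the four numbers are the speeds of source and target ends before and
   after distance [L]. The condition [p <= r] amounts to M^2 - m^2 <= M^2. *)
- move=> cw; have [|||||||phi [phim phie]] := @extremal_potential R w hw cw
    ((M - m) / M) (m / M) (M / (M + m)) (m / (M + m)) L.
  + by field.
  + by field.
  + by rewrite divr_ge0// subr_ge0.
  + rewrite ler_pdivrMr// mulrAC ler_pdivlMr//. nra.
  + by rewrite divr_gt0.
  + by rewrite divr_gt0.
  + by [].
  exists (fun t => phi (t - c)); split.
  + move=> t1 t2 _ _; have := monotone_lipschitz phim (t1 - c) (t2 - c).
    by rewrite opprB addrA subrK.
  + move=> t t0 t1 /=; rewrite add0r subr0 -phie; last exact: mulr_ge0.
    have tL : t * L <= L by rewrite ler_piMl.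
    rewrite !bent_le//=; congr (phi _ - phi _).
      by rewrite bcE; ring.
    by rewrite mulrCA -LE cD; ring.
  + move=> t t0 t1 /=; have tL : L <= L + t * (d - a - L).
      by rewrite lerDl; apply: mulr_ge0 => //; rewrite subr_ge0.
    rewrite -phie; last exact: le_trans tL.
    rewrite !bent_ge//=; congr (phi _ - phi _).
      by rewrite -bcE dbE; ring.
    have -> : c' + t * (a - c') - c = c' - c - t * (c' - a) by ring.
    by rewrite caE -LE cD; ring.
Qed.

(** Mirror image of the preceding case, with source and target exchanged: the overlap [c, b] now
    carries an excess 1/m - 1/M, the interface is [b], and [c'] cuts the target side [b, d]. *)
Lemma sharp_overlap_right (M m : R) : M = d - c -> m = b - a -> m <= M ->
    c <= b -> b <= d ->
  sharp d (1 / (M + m) * I (M * (b - c) / m) (d - a) +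
           (M - m) / M ^+ 2 * I 0 (M * (b - c) / m)).
Proof.
move: (hab) (hcd) (hac) => ab cd ac EM Em mM cb bd; have M0 : 0 < M by rewrite EM subr_gt0.
have m0 : 0 < m by rewrite Em subr_gt0.
have Mm0 : 0 < M + m by rewrite addr_gt0.
have [MN mN MmN] : [/\ M != 0, m != 0 & M + m != 0] by rewrite !gt_eqF.
have [L LD] : exists L, L = M * (b - c) / m by eexists.
rewrite -LD.
have mL : m * L = M * (b - c) by rewrite LD; field.
have L0 : 0 <= L by rewrite LD divr_ge0 ?mulr_ge0 ?(ltW M0) ?(ltW m0)// subr_ge0.
have [M_ge0 m_ge0] : 0 <= M /\ 0 <= m by split; exact: ltW.
have bcL : b - c <= L.
  by rewrite LD ler_pdivlMr// mulrC ler_wpM2r// subr_ge0.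
have [c' cD] : exists c', c' = c + L by eexists.
have Lad : L <= d - a.
  rewrite LD ler_pdivrMr// -subr_ge0 EM Em.
  rewrite (_ : _ - _ = (c - a) * (d - a + (b - c))); last by ring.
  have ad : a <= d by rewrite (le_trans hac)// ltW.
  by rewrite mulr_ge0 ?subr_ge0// addr_ge0 ?subr_ge0.
have caE : c - a = m / (M + m) * (d - a - L).
  apply: (mulfI MmN); have -> : (M + m) * (c - a) = m * (d - a) - m * L.
    by rewrite mL EM Em; ring.
  by field.
have dcE : d - c' = M / (M + m) * (d - a - L).
  apply: (mulfI MmN).
  have -> : (M + m) * (d - c') = M * (d - c) + m * (d - c) - M * L - m * L.
    by rewrite cD; ring.
  rewrite mL (_ : _ * (_ / _ * _) = M * (d - a) - M * L); last by field.
  by rewrite EM Em; ring.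
have c'd : c' <= d.
  rewrite -subr_ge0 dcE; apply: mulr_ge0; last by rewrite subr_ge0.
  exact: divr_ge0 M_ge0 (ltW Mm0).
have bc' : b <= c' by rewrite cD; lra.
have LE : L - (b - c) = (M - m) / M * L by rewrite LD; field; rewrite MN mN.
have bcE : b - c = m / M * L by rewrite LD; field; rewrite MN mN.
have mMV : 0 <= m^-1 - M^-1 by rewrite subr_ge0 lef_pV2.
pose p := Piece b c b c' 0 L (m^-1 - M^-1) M^-1 ((M - m) / M ^+ 2).
pose q := Piece c a c' d L (d - a) m^-1 M^-1 (1 / (M + m)).
rewrite addrC -/(cost w p) -/(cost w q).
apply: (transport_sharp hP hX hw).
- lra.
- split => /=; rewrite ?in_itv/= ?invr_ge0//; try lra.
  + by rewrite distrC ger0_norm ?subr_ge0// bcE; field; rewrite MN mN.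
  + rewrite ger0_norm ?subr_ge0// (_ : c' - b = L - (b - c)).
      by rewrite LE; field.
    by rewrite cD; ring.
- split => /=; rewrite ?in_itv/= ?invr_ge0//; try lra.
  + by rewrite distrC ger0_norm ?subr_ge0// caE; field; rewrite MmN mN.
  + by rewrite ger0_norm ?subr_ge0// dcE; field; rewrite MmN MN.
- move=> f fH; rewrite -EM -Em; exists (M^-1 *: Lintegral P `[c, b] f)%SL.
  have fab : H_class w a b f by exact: H_class_subitv fH _ bd.
  have fcd : H_class w c d f by exact: H_class_subitv fH hac _.
  have fbd : H_class w b d f by exact: H_class_subitv fcd cb _.
  have fcb : H_class w c b f by exact: H_class_subitv fcd _ bd.
  congr (mdist _ _).
    rewrite /source /= !oriented_integral_ge//.
    rewrite (Lintegral_split hP hw fab hac cb) sscaleDr saddA saddC.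
    congr sadd; rewrite -convex_sscaleDl ?invr_ge0//; last first.
      exact: Lintegral_convex fcb _.
    by congr sscale; ring.
  rewrite /target /= !oriented_integral_le//.
  rewrite (Lintegral_split hP hw fcd cb bd) (Lintegral_split hP hw fbd bc' c'd).
  by rewrite !sscaleDr.
- move=> cw; have [|||||||phi [phim phie]] := @extremal_potential R w hw cw
    ((M - m) / M) (m / M) (M / (M + m)) (m / (M + m)) L.
  + by field.
  + by field.
  + by rewrite divr_ge0// subr_ge0.
  + rewrite ler_pdivrMr// mulrAC ler_pdivlMr//. nra.
  + by rewrite divr_gt0.
  + by rewrite divr_gt0.
  + by [].
  (* Reflection at [b] together with the sign change exchanges the roles of source and target. *)
  exists (fun t => - phi (b - t)); split.
  + move=> t1 t2 _ _; have := monotone_lipschitz phim (b - t2) (b - t1).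
    rewrite (_ : b - t2 - (b - t1) = t1 - t2); last by ring.
    by rewrite opprK addrC.
  + move=> t t0 t1 /=; rewrite add0r subr0 -phie; last exact: mulr_ge0.
    have tL : t * L <= L by rewrite ler_piMl.
    rewrite !bent_le//= opprK addrC; congr (phi _ - phi _).
      by rewrite mulrCA -bcE; ring.
    by rewrite mulrCA -LE cD; ring.
  + move=> t t0 t1 /=; have tL : L <= L + t * (d - a - L).
      by rewrite lerDl; apply: mulr_ge0 => //; rewrite subr_ge0.
    rewrite -phie; last exact: le_trans tL.
    rewrite !bent_ge//= opprK addrC; congr (phi _ - phi _).
      have -> : b - (c + t * (a - c)) = b - c + t * (c - a) by ring.
      by rewrite -bcE caE; ring.
    by rewrite dcE -LE cD; ring.
Qed.

Lemma sharp_nested (M m : R) : M = b - a -> m = d - c -> d <= b ->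
  sharp b (if M == m then 0 else (M - m) / M ^+ 2 *
    (I 0 (M * (c - a) / (M - m)) + I 0 (M * (b - d) / (M - m)))).
Proof.
move: (hab) (hcd) (hac) => ab cd ac EM Em db; have M0 : 0 < M by rewrite EM subr_gt0.
have m0 : 0 < m by rewrite Em subr_gt0.
have [Mm|MmN] := eqVneq M m.
  (* Equal lengths and nesting force equal segments, so nothing moves. *)
  have [eac ebd] : a = c /\ b = d by split; lra.
  rewrite /sharp -eac -ebd.
  have bAB : b \in `[a, b] by rewrite in_itv/= (ltW hab) lexx.
  rewrite -[0](addr0 0) -(trivial_piece_cost w b).
  apply: (transport_sharp hP hX hw); first exact: ltW.
  - exact: trivial_piece_valid.
  - exact: trivial_piece_valid.
  - move=> f fH; exists ((b - a)^-1 *: Lintegral P `[a, b] f)%SL.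
    by rewrite trivial_piece_source trivial_piece_target !saddr0.
  - move=> cw; exists (fun=> 0).
    split; [|exact: trivial_piece_extremal|exact: trivial_piece_extremal].
    by move=> t1 t2 _ _; rewrite subrr normr0 (modulus_ge0 hw).
have mM : m < M by rewrite lt_neqAle eq_sym MmN; lra.
have N0 : 0 < M - m by rewrite subr_gt0.
have [MN mN NN] : [/\ M != 0, m != 0 & M - m != 0] by rewrite !gt_eqF.
have [L LD] : exists L, L = M * (c - a) / (M - m) by eexists.
have [K KD] : exists K, K = M * (b - d) / (M - m) by eexists.
rewrite -LD -KD.
have ca0 : 0 <= c - a by rewrite subr_ge0.
have bd0 : 0 <= b - d by rewrite subr_ge0.
have L0 : 0 <= L by rewrite LD divr_ge0 ?mulr_ge0//; exact: ltW.
have K0 : 0 <= K by rewrite KD divr_ge0 ?mulr_ge0//; exact: ltW.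
have caE : c - a = (M - m) / M * L by rewrite LD; field; rewrite NN MN.
have bdE : b - d = (M - m) / M * K by rewrite KD; field; rewrite NN MN.
(* The deficit on [c, d] is cut at [c']: the left flank [a, c] fills [c, c'] and the right flank
   [d, b] fills [c', d]. The extreme distances are those from [a] and from [b] to [c']. *)
have [c' cD] : exists c', c' = c + m / M * L by eexists.
have dcE : d - c' = m / M * K.
  rewrite cD opprD addrA -Em LD KD.
  have -> : b - d = M - m - (c - a) by rewrite EM Em; ring.
  by field; rewrite NN MN.
have ccE : c' - c = m / M * L by rewrite cD; ring.
have mMdiv : 0 <= m / M by rewrite divr_ge0//; exact: ltW.
have cc' : c <= c' by rewrite -subr_ge0 ccE mulr_ge0.
have c'd : c' <= d by rewrite -subr_ge0 dcE mulr_ge0.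
have mMV : 0 <= m^-1 - M^-1 by rewrite subr_ge0 lef_pV2// ltW.
have MV0 : 0 <= M^-1 by rewrite invr_ge0 ltW.
pose p := Piece c a c c' 0 L M^-1 (m^-1 - M^-1) ((M - m) / M ^+ 2).
pose q := Piece d b d c' 0 K M^-1 (m^-1 - M^-1) ((M - m) / M ^+ 2).
rewrite mulrDr -/(cost w p) -/(cost w q).
have LE : (M - m) / M * L + m / M * L = L by field.
have KE : (M - m) / M * K + m / M * K = K by field.
apply: (transport_sharp hP hX hw); first exact: ltW.
- split => //=; rewrite ?in_itv/=; try lra.
  + by rewrite distrC ger0_norm ?subr_ge0// caE; field.
  + by rewrite ger0_norm ?subr_ge0// ccE; field; rewrite MN mN.
- split => //=; rewrite ?in_itv/=; try lra.
  + by rewrite ger0_norm ?subr_ge0// bdE; field.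
  + by rewrite distrC ger0_norm ?subr_ge0// dcE; field; rewrite MN mN.
- move=> f fH; rewrite -EM -Em; exists (M^-1 *: Lintegral P `[c, d] f)%SL.
  have fcb : H_class w c b f by exact: H_class_subitv fH hac _.
  have fcd : H_class w c d f by exact: H_class_subitv fcb _ db.
  have cb : c <= b by rewrite (le_trans (ltW hcd)).
  congr (mdist _ _).
    rewrite /source /= oriented_integral_ge// oriented_integral_le//.
    rewrite (Lintegral_split hP hw fH hac cb).
    rewrite (Lintegral_split hP hw fcb (ltW hcd) db) !sscaleDr !saddA.
    by congr sadd; exact: saddC.
  rewrite /target /= oriented_integral_le// oriented_integral_ge//.
  rewrite -sscaleDr -(Lintegral_split hP hw fcd cc' c'd) -convex_sscaleDl//.
    by congr sscale; ring.
  exact: Lintegral_convex fcd (ltW hcd).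
(* Each flank is a single piece with constant speeds, so the bend is placed at distance 0. *)
- move=> cw; have [|||||||phi [phim phie]] := @extremal_potential R w hw cw
    ((M - m) / M) (m / M) ((M - m) / M) (m / M) 0.
  + by field.
  + by field.
  + by rewrite divr_ge0//; exact: ltW.
  + by [].
  + by rewrite divr_gt0.
  + by rewrite divr_gt0.
  + by [].
  have phiE s : 0 <= s -> phi (m / M * s) - phi (- ((M - m) / M * s)) = w s.
    by move=> s0; rewrite -phie// !bent_ge//= !subr0 !mulr0 !add0r.
  (* Both flanks move towards [c']. One copy of the potential has its interface at [c], a reflected
     copy at [d]; both are normalised to vanish at [c'], where they are glued into a peak. *)
  pose lft t := phi (t - c) - phi (c' - c).
  pose rgt t := phi (d - t) - phi (d - c').
  pose psi t := if t <= c' then lft t else rgt t.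
  have psi_le t : t <= c' -> psi t = lft t by rewrite /psi => ->.
  have psi_ge t : c' <= t -> psi t = rgt t.
    rewrite /psi; case: ifPn => // tc' c't.
    have -> : t = c' by apply/eqP; rewrite eq_le tc' c't.
    by rewrite /lft /rgt !subrr.
  have lftm t1 t2 : t1 <= t2 -> 0 <= lft t2 - lft t1 <= w (t2 - t1).
    move=> t12; have := phim (t1 - c) (t2 - c); rewrite lerD2r => /(_ t12).
    rewrite (_ : t2 - c - (t1 - c) = t2 - t1); last by ring.
    by rewrite (_ : lft t2 - lft t1 = phi (t2 - c) - phi (t1 - c)) // /lft; ring.
  have rgtm t1 t2 : t1 <= t2 -> 0 <= rgt t1 - rgt t2 <= w (t2 - t1).
    move=> t12; have := phim (d - t2) (d - t1); rewrite lerD2l lerN2 => /(_ t12).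
    rewrite (_ : d - t1 - (d - t2) = t2 - t1); last by ring.
    by rewrite (_ : rgt t1 - rgt t2 = phi (d - t1) - phi (d - t2)) // /rgt; ring.
  have lft_c : lft c' = 0 by rewrite /lft subrr.
  have rgt_c : rgt c' = 0 by rewrite /rgt subrr.
  (* Across the peak both values are nonpositive, so their difference is bounded by the larger of
     the two moduli rather than by their sum. *)
  have psiL t1 t2 : t1 <= t2 -> `|psi t1 - psi t2| <= w (t2 - t1).
    move=> t12; have [t2c|/ltW t2c] := leP t2 c'.
      have /andP[h1 h2] := lftm _ _ t12.
      by rewrite !psi_le ?(le_trans t12)// distrC ger0_norm.
    have [t1c|/ltW t1c] := leP t1 c'; last first.
      have /andP[h1 h2] := rgtm _ _ t12.
      by rewrite !psi_ge ?(le_trans t1c)// ger0_norm.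
    rewrite psi_le// psi_ge//.
    have /andP[l1 l2] := lftm _ _ t1c; have /andP[r1 r2] := rgtm _ _ t2c.
    rewrite lft_c rgt_c in l1 l2 r1 r2.
    have w1 : w (c' - t1) <= w (t2 - t1).
      by apply: (modulus_nondecreasing hw); rewrite ?subr_ge0// lerD2r.
    have w2 : w (t2 - c') <= w (t2 - t1).
      by apply: (modulus_nondecreasing hw); rewrite ?subr_ge0// lerD2l lerN2.
    by rewrite ler_norml; apply/andP; split; lra.
  exists psi; split.
  + move=> t1 t2 _ _; have [t12|/ltW t21] := leP t1 t2.
      by rewrite (distrC t1) [`|t2 - t1|]ger0_norm ?subr_ge0// psiL.
    by rewrite distrC [`|t1 - t2|]ger0_norm ?subr_ge0// psiL.
  + move=> t t0 t1 /=; rewrite add0r subr0 -phiE; last exact: mulr_ge0.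
    have tL : t * L <= L by rewrite ler_piMl.
    have e1 : c + t * (c' - c) = c + m / M * (t * L) by rewrite ccE; ring.
    have e2 : c + t * (a - c) = c - (M - m) / M * (t * L).
      by rewrite -[a - c]opprB caE; ring.
    have y1 : c + t * (c' - c) <= c'.
      by rewrite -lerBrDl ler_piMl// subr_ge0.
    have y2 : c + t * (a - c) <= c'.
      by rewrite e2 (le_trans _ cc')// gerBl !mulr_ge0// ?invr_ge0; exact: ltW.
    rewrite !psi_le// e1 e2 /lft.
    by rewrite [c + _ - c]addrC addKr [c - _ - c]addrC addKr; ring.
  + move=> t t0 t1 /=; rewrite add0r subr0 -phiE; last exact: mulr_ge0.
    have tK : t * K <= K by rewrite ler_piMl.
    have e1 : d + t * (c' - d) = d - m / M * (t * K).
      by rewrite -[c' - d]opprB dcE; ring.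
    have e2 : d + t * (b - d) = d + (M - m) / M * (t * K) by rewrite bdE; ring.
    have y1 : c' <= d + t * (c' - d).
      rewrite -lerBlDl -[c' - d]opprB mulrN lerN2.
      by rewrite ler_piMl// subr_ge0.
    have y2 : c' <= d + t * (b - d).
      by rewrite e2 (le_trans c'd)// lerDl !mulr_ge0// ?invr_ge0; exact: ltW.
    rewrite !psi_ge// e1 e2 /rgt subKr.
    have -> : d - (d + (M - m) / M * (t * K)) = - ((M - m) / M * (t * K)) by ring.
    by ring.
Qed.

End Cases.

Theorem theorem2 (R : realType) (X : LSpaceType R)
    (hX : invertible_elements X `&` convex_elements X <> [set theta])
    (P : X -> X) (hP : convexifying P)
    (w : R -> R) (hw : modulus_of_continuity w)
    (a b c d : R) (hab : a < b) (hcd : c < d) (hac : a <= c) :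
  let M : R := Num.max (b - a) (d - c) in
  let m : R := Num.min (b - a) (d - c) in
  let I := fun x y : R => (\int[lebesgue_measure]_(s in `[x, y]) w s)%R in
  let H : set (R -> X) := H_class w a (Num.max b d) in
  let deviation := fun f : R -> X =>
    mdist ((b - a)^-1%R *: Lintegral P `[a, b] f)%SL
          ((d - c)^-1%R *: Lintegral P `[c, d] f)%SL in
  let sharp_bound := fun B : R =>
    (forall f, H f -> deviation f <= B) /\
    (isotropic X -> concave_modulus w ->
      ereal_sup [set (deviation f)%:E | f in H] = B%:E) in
  [/\ [set` `[c, d]] `<=` [set` `[a, b]] ->
        sharp_bound
          (if M == m then 0 else
             (M - m) / M ^+ 2 *
             (I 0 (M * (c - a) / (M - m)) + I 0 (M * (b - d) / (M - m)))),
      b \in `[c, d] ->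
        sharp_bound
          (1 / (M + m) * I (M * (b - c) / m) (d - a) +
           (M - m) / M ^+ 2 * I 0 (M * (b - c) / m)) &
      b <= c ->
        sharp_bound (1 / (M + m) * I (c - b) (d - a))].
Proof.
move=> M m I H deviation sharp_bound.
have MmE : M + m = b - a + (d - c) by exact: addr_max_min.
split.
- move=> cdab; have db : d <= b.
    have /cdab/= : [set` `[c, d]] d by rewrite /= in_itv/= lexx ltW.
    by rewrite in_itv/= => /andP[].
  have cd_le : d - c <= b - a by rewrite lerB.
  have -> : sharp_bound = sharp P w a b c d b.
    by rewrite /sharp_bound /H max_l.
  by apply: (sharp_nested hP hX hw) => //; rewrite ?/M ?/m ?max_l ?min_r.
- rewrite in_itv/= => /andP[cb bd].
  have -> : sharp_bound = sharp P w a b c d d.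
    by rewrite /sharp_bound /H max_r.
  (* The longer segment decides whether the overlap [c, b] carries a deficit or an excess, hence
     which of its ends is the interface. *)
  have [le_m|/ltW le_m] := leP (d - c) (b - a).
    by apply: (sharp_overlap_left hP hX hw) => //; rewrite /M /m ?max_l ?min_r.
  by apply: (sharp_overlap_right hP hX hw) => //; rewrite /M /m ?max_r ?min_l.
- move=> bc; have -> : sharp_bound = sharp P w a b c d d.
    by rewrite /sharp_bound /H max_r// (le_trans bc)// ltW.
  by rewrite MmE; exact: (sharp_disjoint hP hX hw).
Qed.
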